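(* Fix $L\ge 20$. For any pattern $(\mathbf a,\mathbf e)$ there exists $S\subseteq V(\Gamma)$ such that \[p((\mathbf a,\mathbf e)_S)\ge p(\mathbf a,\mathbf e)-150L\sqrt d\] and, for $G$ a random $n$-lift of $H$, \[\mathbb{P}\big((\mathbf a,\mathbf e)_S\text{ can be found in }G\big)\le C\prod_{(i,w)\in S,\,a_{i,w}>0}a_{i,w}^{d/4}\Big(\prod_{(i,w)\in S,\,a_{i,w}>0}\binom{n}{\min(a_{i,w},\lfloor n/2\rfloor)}\Big)^{1-L/10},\] where $C$ is a constant not depending on $n$ or on the pattern.
   Context: $d\ge2$ and $H$ is a $d$-regular graph on $[h]$. A random $n$-lift $G$ of $H$ has vertex set $\{(i,j):i\in[h],j\in[n]\}$, fibres $V_i=\{(i,j):j\in[n]\}$, and for each $ii'\in E(H)$ an independent uniformly random perfect matching between $V_i$ and $V_{i'}$ (no other edges). $D^{>0}=\{2^k/\sqrt{nh}:k\in\mathbb{Z},k\ge0\}$; $\Gamma$ is the graph on $[h]\times D^{>0}$ with $(i,w)\sim_\Gamma(i',w')$ iff $ii'\in E(H)$ and $w/w'\in(d^{-1/2},d^{1/2})$. A pattern is $(\mathbf a,\mathbf e)$: nonnegative integers $a_{i,w}$ with $\sum_wa_{i,w}\le n$ for each $i$, $\sum w^2a_{i,w}\le10$, some $w_0\in D^{>0}$ with $a_{i,w}=0$ unless $w_0\le w\le dw_0$; integers $e_{i,w,i',w'}$ for edges of $\Gamma$ (symmetric) with $0\le e\le\min(a_{i,w},a_{i',w'})$. It can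 be found in $G$ if there are pairwise disjoint $A_{i,w}\subseteq V_i$ with $|A_{i,w}|=a_{i,w}$ and exactly $e_{i,w,i',w'}$ edges of $G$ between $A_{i,w}$ and $A_{i',w'}$ for each edge of $\Gamma$. Potency $p(\mathbf a,\mathbf e)=|\sum_{(i,w)(i',w')\in E(\Gamma)}ww'(e_{i,w,i',w'}-a_{i,w}a_{i',w'}/n)|$. Sub-pattern $(\mathbf a,\mathbf e)_S$: keep $a_{i,w}$ for $(i,w)\in S$ (else $0$) and $e$ on edges with both ends in $S$ (else $0$). *)

(* Defs.v *)
From Stdlib Require Import Reals ClassicalEpsilon.
From mathcomp Require Import all_boot all_fingroup.
Set Implicit Arguments. Unset Strict Implicit. Unset Printing Implicit Defensive.
Local Open Scope R_scope.

Definition decP (P : Prop) : bool :=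
  if excluded_middle_informative P then true else false.

Definition d_regular (h d : nat) (adjH : rel 'I_h) : Prop :=
  (forall i, ~~ adjH i i) /\ (forall i j, adjH i j = adjH j i) /\
  (forall i, #|[set j | adjH i j]| = d).

(* D^{>0} = { 2^k / sqrt(n h) : k >= 0 }; the scale w is indexed by k : nat. *)
Definition wsc (n h k : nat) : R := (INR ((2 ^ k)%N) / sqrt (INR ((n * h)%N))).

Definition Gamma_adj (h d n : nat) (adjH : rel 'I_h)
  (i : 'I_h) (k : nat) (i' : 'I_h) (k' : nat) : Prop :=
  adjH i i' /\
  (/ sqrt (INR d) < wsc n h k / wsc n h k' < sqrt (INR d)).

(* The n-lift determined by f: for each edge ii' of H with i < i', the
   perfect matching j |-> f (i,i') j between V_i and V_i'.  Choosing f
   uniformly from {ffun 'I_h * 'I_h -> {perm 'I_n}} makes the matchings on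
   the edges of H independent and uniform (other coordinates are ignored). *)
Definition lift_adj (h n : nat) (adjH : rel 'I_h)
  (f : {ffun 'I_h * 'I_h -> {perm 'I_n}})
  (i : 'I_h) (j : 'I_n) (i' : 'I_h) (j' : 'I_n) : bool :=
  adjH i i' &&
  ((((i < i')%N) && (f (i, i') j == j')) || (((i' < i)%N) && (f (i', i) j' == j))).

(* a i k = a_{i,w_k} vanishes at all scales k >= K (every pattern has finite
   support, so some such K exists; K is only used to write sums/products). *)
Definition supported_below (h K : nat) (a : 'I_h -> nat -> nat) : Prop :=
  forall i k, (K <= k)%N -> a i k = 0%N.

Definition is_pattern (h d n K : nat) (adjH : rel 'I_h)
  (a : 'I_h -> nat -> nat) (e : 'I_h -> nat -> 'I_h -> nat -> nat) : Prop :=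
  (forall i, (\sum_(k < K) a i k <= n)%N) /\
  (\big[Rplus/0]_(i < h) \big[Rplus/0]_(k < K)
      (wsc n h k ^ 2 * INR (a i k)) <= 10) /\
  (exists k0 : nat, forall i k, a i k <> 0%N ->
      (wsc n h k0 <= wsc n h k <= INR d * wsc n h k0)) /\
  (forall i k i' k', Gamma_adj d n adjH i k i' k' ->
      e i k i' k' = e i' k' i k /\ (e i k i' k' <= minn (a i k) (a i' k'))%N).

(* Potency: |sum over edges (i,w)(i',w') of Gamma of w w' (e - a a'/n)|.
   Each (unordered) edge of Gamma is counted once via i < i' (edges of H
   join distinct vertices). *)
Definition potency (h d n K : nat) (adjH : rel 'I_h)
  (a : 'I_h -> nat -> nat) (e : 'I_h -> nat -> 'I_h -> nat -> nat) : R :=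
  Rabs (\big[Rplus/0]_(i < h) \big[Rplus/0]_(i' < h | (i < i')%N)
        \big[Rplus/0]_(k < K)
        \big[Rplus/0]_(k' < K | decP (Gamma_adj d n adjH i k i' k'))
          (wsc n h k * wsc n h k' *
            (INR (e i k i' k') - INR (a i k) * INR (a i' k') / INR n))).

Definition sub_a (h : nat) (S : 'I_h -> nat -> bool) (a : 'I_h -> nat -> nat)
  : 'I_h -> nat -> nat := fun i k => if S i k then a i k else 0%N.
Definition sub_e (h : nat) (S : 'I_h -> nat -> bool)
  (e : 'I_h -> nat -> 'I_h -> nat -> nat) : 'I_h -> nat -> 'I_h -> nat -> nat :=
  fun i k i' k' => if S i k && S i' k' then e i k i' k' else 0%N.

Definition found (h d n : nat) (adjH : rel 'I_h)
  (f : {ffun 'I_h * 'I_h -> {perm 'I_n}})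
  (a : 'I_h -> nat -> nat) (e : 'I_h -> nat -> 'I_h -> nat -> nat) : Prop :=
  exists A : 'I_h -> nat -> {set 'I_n},
    (forall i k, #|A i k| = a i k) /\
    (forall i k k', k <> k' -> [disjoint A i k & A i k']) /\
    (forall i k i' k', Gamma_adj d n adjH i k i' k' ->
       #|[set p : 'I_n * 'I_n | (p.1 \in A i k) && (p.2 \in A i' k')
                                 && lift_adj adjH f i p.1 i' p.2]|
       = e i k i' k').

Definition prob_found (h d n : nat) (adjH : rel 'I_h)
  (a : 'I_h -> nat -> nat) (e : 'I_h -> nat -> 'I_h -> nat -> nat) : R :=
  (INR #|[set f : {ffun 'I_h * 'I_h -> {perm 'I_n}} | decP (found d adjH f a e)]|
   / INR #|{ffun 'I_h * 'I_h -> {perm 'I_n}}|).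

(* Main.v *)
(** Write [m = a_u a_v / n] for the expected and [e] for the prescribed number
    of edges between the classes [u] and [v].  Up to factors polynomial in the
    class sizes, a fixed placement of the classes realises the pattern with
    probability [exp (- D)], where [D] is the sum over the edges of Gamma of
    [m phi (e / m)], [phi r = r ln r - r + 1]; there are at most
    [exp (\sum_u l_u)] placements, where [l_u = a_u (1 + ln (n / a_u))].  So it
    suffices that every vertex of [S] meets edges of total cost at least
    [3/10 L l_u].  Vertices violating this are deleted one at a time.

    Each deletion is cheap.  Let [rho = w_v / (w_u sqrt d) < 1].  By
    [edge_trichotomy] every edge at a deleted [u] satisfies one of:
    - [|e - m| ^ 2 <= 6 m cost]: the sum over such edges is controlled by
      Cauchy-Schwarz, with a loss that is summable over the dyadic scales of
      [w_u] because [a ln(1/a)^2] is bounded;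
    - [|e - m| <= rho ^ 2 a_v]: the contributions are at most
      [w_v ^ 2 a_v rho / sqrt d], a geometric series in the scale of [w_u];
    - [rho (1 + ln (n / a_u)) |e - m| <= 20 cost]: the sum is at most
      [6 L sqrt d w_u ^ 2 a_u] because the total cost at [u] is small.
    As [\sum_u w_u ^ 2 a_u <= 10], the total loss is at most [150 L sqrt d]. *)

From Stdlib Require Import Reals.
From mathcomp Require Import all_boot all_order all_fingroup all_algebra.
From mathcomp Require Import ring lra reals Rstruct Rstruct_topology.
From mathcomp Require Import sequences exp.
Require Import Defs.
Import Order.TTheory GRing.Theory Num.Theory.
Set Implicit Arguments. Unset Strict Implicit. Unset Printing Implicit Defensive.
Local Open Scope ring_scope.

(** * The cost of one edge of Gamma *)

Section Edge.
Variable R : realType.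
Implicit Types (x y r m e : R).

Lemma ln_le_subr1 x : 0 < x -> ln x <= x - 1.
Proof.
move=> x0; have := @le_ln1Dx R (x - 1).
by rewrite addrCA subrr addr0; apply; lra.
Qed.

Lemma ln_sqr x : 0 < x -> ln (x ^+ 2) = 2 * ln x.
Proof. by move=> x0; rewrite lnXn // mulr2n mulrDl !mul1r. Qed.

Lemma ln_ge_1subV x : 0 < x -> 1 - x^-1 <= ln x.
Proof.
move=> x0; have := @ln_le_subr1 x^-1; rewrite invr_gt0 => /(_ x0).
by rewrite lnV ?posrE //; lra.
Qed.

(* [m * phi (e / m)] where [phi r = r ln r - r + 1]; since [ln 0 = 0] here, the
   value at [e = 0] is [m], as it should be. *)
Definition poisson_cost (e m : R) : R := e * ln (e / m) - e + m.

(** With [e = m y ^ 2] the difference of the two sides is [2 m y (y ln y - y + 1)], and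
    [ln y >= 1 - 1 / y]. *)
Lemma poisson_cost_sqrt y m : 0 <= y -> 0 < m ->
  m * (y - 1) ^+ 2 <= poisson_cost (m * y ^+ 2) m.
Proof.
rewrite le_eqVlt => /orP[/eqP <-|y0] m0; rewrite /poisson_cost.
  by rewrite expr0n /= mulr0 !mul0r; lra.
rewrite [m * _ / m]mulrAC divff ?mul1r; last by rewrite gt_eqF.
rewrite ln_sqr //.
have /(ler_wpM2l (ltW y0)) := ln_ge_1subV y0.
rewrite mulrBr mulr1 divff ?gt_eqF // => h.
have : 0 <= y * ln y - (y - 1) by lra.
move=> /(mulr_ge0 (ltW (mulr_gt0 m0 y0))); nra.
Qed.

Lemma poisson_cost_ge0 e m : 0 <= e -> 0 <= m -> (m = 0 -> e = 0) ->
  0 <= poisson_cost e m.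
Proof.
move=> e0; rewrite le_eqVlt => /orP[/eqP <- /(_ erefl) ->|m0 _].
  by rewrite /poisson_cost mul0r; lra.
have := @poisson_cost_sqrt (Num.sqrt (e / m)) m (sqrtr_ge0 _) m0.
have rE : 0 <= e / m by rewrite divr_ge0 // ltW.
have mE : m * (e / m) = e by rewrite mulrCA divff ?mulr1 // gt_eqF.
rewrite sqr_sqrtr // mE; apply: le_trans.
by rewrite mulr_ge0 ?sqr_ge0 // ltW.
Qed.

Lemma poisson_cost_upper y m : 1 <= y -> 0 < m ->
  4^-1 * (m * y ^+ 2 - m) * ln (y ^+ 2) <= poisson_cost (m * y ^+ 2) m.
Proof.
move=> y1 m0; have y0 : 0 < y by lra.
rewrite /poisson_cost [m * _ / m]mulrAC divff ?gt_eqF // mul1r ln_sqr //.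
have /(ler_wpM2l (ltW y0)) := ln_ge_1subV y0.
rewrite mulrBr mulr1 divff ?gt_eqF // => h.
set l := ln y in h *.
have l0 : 0 <= l by rewrite ln_ge0.
suff: 0 <= m * ((3 * y ^+ 2 + 1) * l / 2 - y ^+ 2 + 1) by lra.
apply: mulr_ge0; first lra.
rewrite -(pmulr_rge0 _ y0).
(* After multiplication by [y] the claim is a positive combination of [y ln y - (y - 1)] and
   [(y - 1) ^ 3]. *)
have -> : y * ((3 * y ^+ 2 + 1) * l / 2 - y ^+ 2 + 1) =
  (3 * y ^+ 2 + 1) / 2 * (y * l - (y - 1)) + (y - 1) ^+ 3 / 2 by field.
apply: addr_ge0; first by apply: mulr_ge0; nra.
by apply: divr_ge0 => //; apply: exprn_ge0; lra.
Qed.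

Lemma ln2_ge : 1 / 2 <= ln (2 : R).
Proof. by have := @ln_ge_1subV 2 ltac:(lra); lra. Qed.

(* The first alternative covers [e <= 2 m]; beyond that [cost >= |e - m| ln (e / m) / 4],
   and [e / m > rho ^+ 2 * n / au] makes the logarithm comparable to [rho (1 + ln (n / au))]. *)
Lemma edge_trichotomy (n au av e rho : R) :
  0 < n -> 0 < au -> au <= n -> 0 < av -> 0 <= e -> 0 < rho <= 1 ->
  let m := au * av / n in
  [\/ (e - m) ^+ 2 <= 6 * m * poisson_cost e m,
      `|e - m| <= rho ^+ 2 * av |
      rho * (1 + ln (n / au)) * `|e - m| <= 20 * poisson_cost e m].
Proof.
move=> n0 au0 aun av0 e0 /andP[r0 r1] m.
have m0 : 0 < m by rewrite divr_gt0 // mulr_gt0.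
set y := Num.sqrt (e / m).
have y0 : 0 <= y by exact: sqrtr_ge0.
have eE : e = m * y ^+ 2.
  rewrite sqr_sqrtr; last by rewrite divr_ge0 // ltW.
  by rewrite mulrCA divff ?gt_eqF // mulr1.
have [y2|y2] := leP (y ^+ 2) 2.
  constructor 1.
  have := poisson_cost_sqrt y0 m0; rewrite -eE => /(ler_wpM2l (ltW m0)) h.
  rewrite -mulrA; apply: le_trans (ler_wpM2l _ h); last lra.
  rewrite [X in X - m]eE.
  (* The constant [6] bounds [(y + 1) ^ 2] for [y ^ 2 <= 2]. *)
  have -> : (m * y ^+ 2 - m) ^+ 2 = (m * (y - 1)) ^+ 2 * (y + 1) ^+ 2 by ring.
  have -> : 6 * (m * (m * (y - 1) ^+ 2)) = (m * (y - 1)) ^+ 2 * 6 by ring.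
  by apply: ler_wpM2l; [exact: sqr_ge0|nra].
have [D2|D2] := leP `|e - m| (rho ^+ 2 * av); first by constructor 2.
constructor 3.
have y1 : 1 <= y by nra.
have em : 0 <= e - m by rewrite eE; nra.
rewrite ger0_norm // in D2 *.
have := poisson_cost_upper y1 m0; rewrite -eE => h.
set lr := ln (y ^+ 2) in h.
have lr2 : 1 / 2 <= lr.
  by apply: le_trans ln2_ge _; rewrite ler_ln ?posrE //; lra.
(* This is where [20 = 5 * 4] comes from. The [5] results from
   [rho ln (n / au) <= rho lr - 2 rho ln rho], [- rho ln rho <= 1 - rho] and [lr >= 1 / 2]. *)
suff th : rho * (1 + ln (n / au)) <= 5 * lr.
  have := ler_wpM2r em th; lra.
have X1 : 0 < n / au by rewrite divr_gt0.
have rX : rho ^+ 2 * (n / au) <= y ^+ 2.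
  rewrite mulrA ler_pdivrMr //.
  rewrite eE in D2.
  have : rho ^+ 2 * av * n < (y ^+ 2 - 1) * au * av.
    have -> : (y ^+ 2 - 1) * au * av = (m * y ^+ 2 - m) * n.
      by rewrite /m; field; rewrite gt_eqF.
    by rewrite ltr_pM2r.
  rewrite [rho ^+ 2 * av * n]mulrAC ltr_pM2r // => ?; nra.
have lX : 2 * ln rho + ln (n / au) <= lr.
  rewrite -ln_sqr // -lnM ?posrE ?exprn_gt0 //.
  by rewrite ler_ln ?posrE //; [rewrite mulr_gt0 // exprn_gt0|lra].
have /(ler_wpM2l (ltW r0)) := ln_ge_1subV r0.
rewrite mulrBr mulr1 divff ?gt_eqF // => hr.
have := ler_wpM2l (ltW r0) lX; nra.
Qed.

End Edge.

(** * Sums over dyadic scales *)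

Section Dyadic.
Variable R : realType.

Lemma dyadic_sum_below (c M : R) K : 0 < c -> 0 <= M ->
  \sum_(k < K) (if 2 ^+ k * c <= M then 2 ^+ k * c else 0) <= 2 * M.
Proof.
move=> c0 M0.
(* The extra [- c] lets the induction close when [c] is doubled. *)
suff: \sum_(k < K) (if 2 ^+ k * c <= M then 2 ^+ k * c else 0)
      <= if c <= M then 2 * M - c else 0 by case: ifP => _; lra.
elim: K c c0 => [|K IH] c c0; first by rewrite big_ord0; case: ifP => ?; lra.
rewrite big_ord_recl /= expr0 mul1r.
under eq_bigr => k _ do rewrite /bump /= add1n exprSr -mulrA.
have := IH (2 * c) ltac:(lra).
set s := \sum_(_ < _) _.
by case: (leP (2 * c) M) => ?; case: (leP c M) => ?; lra.
Qed.

Lemma dyadic_sum_above (c M : R) K : 0 < c -> 0 < M ->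
  \sum_(k < K) (if M <= 2 ^+ k * c then (2 ^+ k * c)^-1 else 0) <= 2 / M.
Proof.
move=> c0 M0.
suff: \sum_(k < K) (if M <= 2 ^+ k * c then (2 ^+ k * c)^-1 else 0)
      <= 2 / Num.max M c.
  move/le_trans; apply; apply: ler_wpM2l => //.
  by rewrite lef_pV2 ?posrE ?lt_max ?M0 // le_max lexx.
elim: K c c0 => [|K IH] c c0.
  by rewrite big_ord0 divr_ge0 // le_max ltW.
rewrite big_ord_recl /= expr0 mul1r.
under eq_bigr => k _ do rewrite /bump /= add1n exprSr -mulrA.
have := IH (2 * c) ltac:(lra).
set s := \sum_(_ < _) _.
case: (leP M c) => Mc.
  rewrite max_r; last lra.
  have -> : 2 / (2 * c) = c^-1 by rewrite invfM mulrA divff ?mul1r // pnatr_eq0.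
  lra.
move=> h; rewrite add0r; apply: le_trans h _; apply: ler_wpM2l => //.
by rewrite lef_pV2 ?posrE ?lt_max ?M0 // le_max lexx.
Qed.

(** The two arguments of the minimum cross at [2 ^ k c = b]; on each side a geometric series
    contributes at most [2 b ^ 2]. *)
Lemma dyadic_sum_min (c b : R) K : 0 < c -> 0 <= b ->
  \sum_(k < K) Num.min (2 ^+ k * c * b) (b ^+ 3 / (2 ^+ k * c)) <= 4 * b ^+ 2.
Proof.
move=> c0; rewrite le_eqVlt => /orP[/eqP <-|b0].
  rewrite big1 ?expr0n ?mulr0 // => k _.
  by rewrite mulr0 mul0r minxx.
apply: (@le_trans _ _ (\sum_(k < K)
   ((if 2 ^+ k * c <= b then 2 ^+ k * c else 0) * b +
    b ^+ 3 * (if b <= 2 ^+ k * c then (2 ^+ k * c)^-1 else 0)))).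
  apply: ler_sum => k _.
  have w0 : 0 < 2 ^+ k * c by rewrite mulr_gt0 // exprn_gt0.
  case: (leP (2 ^+ k * c) b) => h1; case: (leP b (2 ^+ k * c)) => h2.
  - by rewrite ge_min lerDl mulr_ge0 ?invr_ge0 ?exprn_ge0 // ltW.
  - by rewrite ge_min mulr0 addr0 lexx.
  - by rewrite ge_min mul0r add0r lexx orbT.
  - by move: (lt_trans h1 h2); rewrite ltxx.
rewrite big_split /= -mulr_suml -mulr_sumr.
have h1 := ler_wpM2r (ltW b0) (dyadic_sum_below K c0 (ltW b0)).
have h2 := ler_wpM2l (exprn_ge0 3 (ltW b0)) (dyadic_sum_above K c0 b0).
apply: le_trans (lerD h1 h2) _.
have -> : b ^+ 3 * (2 / b) = 2 * b ^+ 2 by field; rewrite gt_eqF.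
by rewrite -mulrA -expr2; lra.
Qed.

(** Let [y] be the square root on the left. If [y b <= w], the first term on the right suffices.
    Otherwise the boundedness of [al y] and [al y ^ 3] yields the minimum. The first term is paid by
    the weight of a vertex, the second is summable by [dyadic_sum_min]. *)
Lemma entropy_weight_split (al w b : R) : 0 < al <= 1 -> 0 < w -> 0 <= b ->
  al * Num.sqrt (1 + ln al^-1) * w * b
    <= al * w ^+ 2 + 4 * Num.min (w * b) (b ^+ 3 / w).
Proof.
move=> /andP[a0 a1] w0 b0.
set z := Num.sqrt al^-1; set y := Num.sqrt _.
have z0 : 0 < z by rewrite sqrtr_gt0 invr_gt0.
have z2 : al * z ^+ 2 = 1.
  by rewrite sqr_sqrtr ?divff ?gt_eqF // invr_ge0 ltW.
have lz : ln al^-1 = 2 * ln z.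
  by rewrite -ln_sqr // sqr_sqrtr // invr_ge0 ltW.
have z1 : 1 <= z by nra.
have lz0 : 0 <= ln z by exact: ln_ge0.
have lz1 := ln_le_subr1 z0.
have y2 : y ^+ 2 = 1 + 2 * ln z by rewrite sqr_sqrtr ?lz //; lra.
have y0 : 0 <= y by exact: sqrtr_ge0.
have y1 : 1 <= y by nra.
have yz : y ^+ 2 <= 2 * z by lra.
have aly : al * y <= 1.
  apply: le_trans (_ : al * z ^+ 2 <= 1); last lra.
  by apply: ler_wpM2l; [lra | nra].
have aly3 : al * y ^+ 3 <= 4.
  apply: le_trans (_ : al * (4 * z ^+ 2) <= 4); last lra.
  by apply: ler_wpM2l; [lra | nra].
have mn0 : 0 <= Num.min (w * b) (b ^+ 3 / w).
  by rewrite le_min mulr_ge0 ?divr_ge0 ?exprn_ge0 // ltW.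
have [h|h] := leP (y * b) w.
  suff: al * y * w * b <= al * w ^+ 2 by lra.
  have -> : al * y * w * b = al * w * (y * b) by ring.
  by rewrite expr2 mulrA; apply: ler_wpM2l => //; rewrite mulr_ge0 // ltW.
have aw : 0 <= al * w ^+ 2 by rewrite mulr_ge0 ?sqr_ge0 // ltW.
suff: al * y * w * b <= 4 * Num.min (w * b) (b ^+ 3 / w) by lra.
have wb0 : 0 <= w * b by rewrite mulr_ge0 // ltW.
have [wb|wb] := leP w b.
  rewrite min_l; first by rewrite -mulrA; nra.
  rewrite ler_pdivlMr //.
  have -> : b ^+ 3 = b * b ^+ 2 by ring.
  have -> : w * b * w = b * w ^+ 2 by ring.
  by apply: ler_wpM2l => //; nra.
rewrite min_r; last first.
  rewrite ler_pdivrMr //.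
  have -> : b ^+ 3 = b * b ^+ 2 by ring.
  have -> : w * b * w = b * w ^+ 2 by ring.
  by apply: ler_wpM2l => //; nra.
rewrite mulrA ler_pdivlMr //.
have -> : al * y * w * b * w = b * (al * y * w ^+ 2) by ring.
have -> : 4 * b ^+ 3 = b * (4 * b ^+ 2) by ring.
apply: ler_wpM2l => //.
apply: le_trans (_ : al * y * (y * b) ^+ 2 <= _).
  by apply: ler_wpM2l; [rewrite mulr_ge0 // ltW | nra].
have -> : al * y * (y * b) ^+ 2 = al * y ^+ 3 * b ^+ 2 by ring.
by apply: ler_wpM2r => //; exact: sqr_ge0.
Qed.

End Dyadic.

(** * Greedy deletion of vertices in a finite weighted graph *)

Section Pruning.
Variables (R : realFieldType) (V : finType).
Variables (x cost : V -> V -> R) (G : rel V) (lam bound : V -> R).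

Hypothesis Gsym : forall u v, G u v = G v u.
Hypothesis Girr : forall u, ~~ G u u.
Hypothesis xsym : forall u v, G u v -> x u v = x v u.
Hypothesis lam_ge0 : forall u, 0 <= lam u.
Hypothesis loss : forall (S : {set V}) u, u \in S ->
  \sum_(v in S | G u v) cost u v < bound u ->
  `|\sum_(v in S | G u v) x u v| <= lam u.

Let X (S : {set V}) := \sum_(u in S) \sum_(v in S | G u v) x u v.

(** [X] counts ordered pairs, so [u] occurs in each coordinate, with equal contributions by
    symmetry. *)
Lemma remove_vertex (S : {set V}) u : u \in S ->
  X S = X (S :\ u) + 2 * \sum_(v in S | G u v) x u v.
Proof.
move=> uS; rewrite /X (big_setD1 u uS) /=.
have E v : v \in S :\ u ->
    \sum_(t in S | G v t) x v t =
    \sum_(t in S :\ u | G v t) x v t + (if G u v then x u v else 0).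
  move=> vS; rewrite (bigID (fun t => t == u)) /= addrC; congr (_ + _).
    by apply: eq_bigl => t; rewrite !inE; case: (t == u); rewrite ?andbF ?andbT.
  case: ifPn => guv.
    rewrite (big_pred1 u) => [|t].
      by apply: xsym; rewrite Gsym.
    rewrite /=; have [->|tu] := eqVneq t u; last by rewrite andbF.
    by rewrite uS Gsym guv.
  rewrite big1 // => t /andP[/andP[_ gt] /eqP tu].
  by move: gt; rewrite tu Gsym (negbTE guv).
rewrite (eq_bigr _ E) big_split /= -big_mkcondr /=.
have -> : \sum_(v in S :\ u | G u v) x u v = \sum_(v in S | G u v) x u v.
  apply: eq_bigl => v; rewrite !inE.
  by case: (v =P u) => [->|//]; rewrite (negbTE (Girr u)) !andbF.
ring.
Qed.

(** Vertices violating the bound are deleted until none is left. A deletion changes [X] by at most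
    [2 * lam u], and no vertex is deleted twice. The set present at a deletion is not known
    beforehand, so [loss] quantifies over all [S]. *)
Lemma prune : exists S : {set V},
  `|X [set: V]| - 2 * \sum_u lam u <= `|X S| /\
  forall u, u \in S -> bound u <= \sum_(v in S | G u v) cost u v.
Proof.
suff: forall N (S : {set V}), #|S| = N -> exists T : {set V},
  `|X S| - 2 * \sum_(u in S) lam u <= `|X T| /\
  forall u, u \in T -> bound u <= \sum_(v in T | G u v) cost u v.
  move=> /(_ _ [set: V] erefl) [T [h1 h2]]; exists T; split => //.
  by under eq_bigl => u do rewrite -(in_setT u).
elim=> [|N IH] S cS.
  exists S; split; first by rewrite lerBlDr lerDl mulr_ge0 // sumr_ge0.
  by move=> u; move/eqP: cS; rewrite cards_eq0 => /eqP ->; rewrite inE.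
have [/existsP[u /andP[uS ub]]|] :=
  boolP [exists u, (u \in S) && (\sum_(v in S | G u v) cost u v < bound u)].
  have cSu : #|S :\ u| = N by move: cS; rewrite (cardsD1 u) uS => -[].
  have [T [h1 h2]] := IH _ cSu; exists T; split => //.
  apply: le_trans h1; rewrite (remove_vertex uS) (big_setD1 u uS) /= mulrDr.
  have := loss uS ub; set l := \sum_(v in S | _) _ => hl.
  have := ler_normD (X (S :\ u)) (2 * l).
  rewrite normrM [`|2|]ger0_norm // => ?; lra.
rewrite negb_exists => /forallP h; exists S; split.
  by rewrite lerBlDr lerDl mulr_ge0 // sumr_ge0.
by move=> u uS; have := h u; rewrite uS /= -leNgt.
Qed.

End Pruning.

Ltac nonneg := repeat first
  [ done | exact: ltW | exact: sqr_ge0 | apply: mulr_ge0 | rewrite invr_ge0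
  | apply: addr_ge0 | apply: exprn_ge0 | lra ].

(** * Selecting the vertices to keep, with the total loss *)

Section Selection.
Variables (R : realType) (h K d : nat) (adj : rel 'I_h) (c n sd L : R).
Let V := ('I_h * 'I_K)%type.
Variables (a : V -> R) (e : V -> V -> R).

Let w (u : V) : R := 2 ^+ u.2 * c.
Let G (u v : V) := adj u.1 v.1 && (sd^-1 < w u / w v < sd).
Let m u v := a u * a v / n.
Let x u v := w u * w v * (e u v - m u v).
Let theta u := 1 + ln (n / a u).
Let cost u v := poisson_cost (e u v) (m u v).

Hypothesis adj_sym : forall i j, adj i j = adj j i.
Hypothesis adj_irr : forall i, ~~ adj i i.
Hypothesis adj_deg : forall i, #|[set j | adj i j]| = d.
(* [c] will be [1 / sqrt (n h)], which is [0] when [h = 0]. *)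
Hypothesis c0 : 'I_h -> 0 < c.
Hypothesis n0 : 0 < n.
Hypothesis sd1 : 1 <= sd.
Hypothesis sd2 : sd ^+ 2 = d%:R.
Hypothesis L20 : 20 <= L.
Hypothesis a_bnd : forall u, a u = 0 \/ 0 < a u <= n.
Hypothesis weight : \sum_u w u ^+ 2 * a u <= 10.
Hypothesis e_sym : forall u v, G u v -> e u v = e v u.
Hypothesis e_bnd : forall u v, G u v -> [/\ 0 <= e u v, e u v <= a u & e u v <= a v].

Let w0 u : 0 < w u. Proof. by rewrite mulr_gt0 ?exprn_gt0 // (c0 u.1). Qed.
Let sd0 : 0 < sd. Proof. by have := sd1; lra. Qed.
Let d0 : 0 < d%:R :> R. Proof. by rewrite -sd2 exprn_gt0. Qed.
Let a0 u : 0 <= a u.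
Proof. by case: (a_bnd u) => [->//|/andP[/ltW]]. Qed.

Let W (i : 'I_h) := \sum_(v | adj i v.1) w v ^+ 2 * a v.
(** The critical scale of [w u] on fibre [i], normalised so that the sum of the [b i ^+ 2] is at
    most [10 / n]. *)
Let b (i : 'I_h) : R := Num.sqrt (W i / (d%:R * n)).
Let rho u v := w v / (w u * sd).
(* One summand for each alternative of [edge_trichotomy] (third, second, first). *)
Let lam (u : V) := 6 * L * sd * (w u ^+ 2 * a u)
  + sd^-1 * (\sum_(v | G u v) w v ^+ 2 * a v * rho u v)
  + 3 / 10 * L * sd * (w u ^+ 2 * a u
     + 4 * n * Num.min (w u * b u.1) (b u.1 ^+ 3 / w u)).

Let W0 i : 0 <= W i.
Proof. by apply: sumr_ge0 => v _; rewrite mulr_ge0 ?sqr_ge0. Qed.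

Let b0 i : 0 <= b i. Proof. exact: sqrtr_ge0. Qed.

Let b2 i : W i = d%:R * n * b i ^+ 2.
Proof.
rewrite sqr_sqrtr; last by rewrite divr_ge0 // mulr_ge0 // ltW.
by rewrite mulrC divfK // gt_eqF // mulr_gt0.
Qed.

Let wa0 u : 0 <= w u ^+ 2 * a u. Proof. by rewrite mulr_ge0 ?sqr_ge0. Qed.

Let rho0 u v : 0 < rho u v.
Proof. by rewrite divr_gt0 // mulr_gt0. Qed.

Let rho1 u v : G u v -> rho u v <= 1.
Proof.
move=> /andP[_ /andP[h1 _]].
have wu := mulr_gt0 (w0 u) sd0; rewrite /rho ler_pdivrMr // mul1r ltW //.
by move: h1; rewrite ltr_pdivlMr // mulrC ltr_pdivrMr.
Qed.

Let lam0 u : 0 <= lam u.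
Proof.
have L20' := L20; have L0 : 0 <= L by lra.
have mn : 0 <= Num.min (w u * b u.1) (b u.1 ^+ 3 / w u).
  rewrite le_min mulr_ge0 ?divr_ge0 ?exprn_ge0 //; exact: ltW.
rewrite /lam; apply: addr_ge0; first apply: addr_ge0.
- by apply: mulr_ge0 => //; apply: mulr_ge0; [lra | exact: ltW].
- rewrite mulr_ge0 ?invr_ge0 ?(ltW sd0) //; apply: sumr_ge0 => v _.
  exact: mulr_ge0 (wa0 v) (ltW (rho0 u v)).
- rewrite mulr_ge0 //; first by rewrite !mulr_ge0 // ?ltW //; lra.
  by rewrite addr_ge0 // !mulr_ge0 // ltW.
Qed.

Let cost0 u v : G u v -> 0 <= cost u v.
Proof.
move=> guv; have [e0 eu ev] := e_bnd guv.
apply: poisson_cost_ge0 => //; first by rewrite divr_ge0 ?mulr_ge0 // ltW.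
move=> /eqP; rewrite !mulf_eq0 invr_eq0 (gt_eqF n0) orbF.
by case/orP => /eqP z; apply/eqP; rewrite eq_le e0 andbT -z.
Qed.

Let theta1 u : 1 <= theta u.
Proof.
rewrite /theta lerDl; case: (a_bnd u) => [->|/andP[h1 h2]].
  by rewrite invr0 mulr0 ln0.
by rewrite ln_ge0 // ler_pdivlMr // mul1r.
Qed.

(** The bounds for all three alternatives of [edge_trichotomy] are added, since any of them may
    hold. The first is split by AM-GM, with a weight [t] chosen later for each [u]. *)
Let edge_loss u v (t : R) : 0 < a u -> G u v -> 0 < t ->
  `|x u v| <= 2^-1 * (t * w u ^+ 2 * (a u / n) * (w v ^+ 2 * a v) + 6 / t * cost u v)
    + sd^-1 * (w v ^+ 2 * a v * rho u v)
    + 20 * sd * w u ^+ 2 / theta u * cost u v.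
Proof.
move=> au guv t0; have [e0 eu ev] := e_bnd guv; have cp := cost0 guv.
have th1 := theta1 u.
set A := 2^-1 * _; set N := sd^-1 * _; set P := 20 * sd * _ * _ * _.
have A0 : 0 <= A.
  apply: mulr_ge0; first lra.
  apply: addr_ge0; last first.
    by apply: mulr_ge0 => //; rewrite divr_ge0 // ltW.
  rewrite mulr_ge0 //; apply: mulr_ge0; last by rewrite divr_ge0 // ltW.
  by rewrite mulr_ge0 ?sqr_ge0 // ltW.
have N0 : 0 <= N.
  by rewrite mulr_ge0 ?invr_ge0 ?(ltW sd0) // mulr_ge0 // ltW.
have sw0 : 0 <= sd * w u ^+ 2 / theta u.
  apply: divr_ge0; last exact: le_trans ler01 th1.
  by rewrite mulr_ge0 ?sqr_ge0 // ltW.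
have P0 : 0 <= P.
  have -> : P = 20 * (sd * w u ^+ 2 / theta u * cost u v) by rewrite /P !mulrA.
  exact: (mulr_ge0 (ler0n _ _) (mulr_ge0 sw0 cp)).
(* For an empty class [v] the bounds on [e] force [e u v = 0], so [x u v = 0]. *)
case: (a_bnd v) => [av|/andP[av avn]].
  have e00 : e u v = 0 by apply/eqP; rewrite eq_le e0 andbT -av.
  by rewrite /x /m e00 av mulr0 mul0r subr0 mulr0 normr0 !addr_ge0.
have aun : a u <= n by case: (a_bnd u) => [z|/andP[]//]; move: au; rewrite z ltxx.
have xE : `|x u v| = w u * w v * `|e u v - m u v|.
  by rewrite /x normrM ger0_norm // mulr_ge0 // ltW.
have rE : w u * rho u v = w v / sd by rewrite /rho; field; rewrite !gt_eqF.
have w00 := w0 u; have w0v := w0 v; have r0 := rho0 u v.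
have [] := edge_trichotomy n0 au aun av e0 (n:=n) (rho:=rho u v).
- by rewrite rho0 rho1.
- rewrite -/(m u v) -/(cost u v) => hD.
  suff: `|x u v| <= A by lra.
  rewrite xE; set D := `|_|.
  have D0 : 0 <= D by exact: normr_ge0.
  have D2 : D ^+ 2 <= 6 * m u v * cost u v by rewrite real_normK ?num_real.
  set p := t * w u ^+ 2 * (a u / n) * (w v ^+ 2 * a v).
  have pE : p = t * (w u * w v) ^+ 2 * m u v by rewrite /p /m; field; rewrite gt_eqF.
  have m0 : 0 <= m u v by rewrite /m; nonneg.
  have p0 : 0 <= p by rewrite pE; nonneg.
  rewrite -(@ler_pXn2r _ 2) ?nnegrE //; last by nonneg.
  apply: le_trans (_ : (w u * w v) ^+ 2 * (6 * m u v * cost u v) <= _).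
    rewrite [X in X <= _]exprMn; by apply: ler_wpM2l => //; exact: sqr_ge0.
  have -> : (w u * w v) ^+ 2 * (6 * m u v * cost u v) = p * (6 / t * cost u v).
    by rewrite pE; field; rewrite gt_eqF.
  (* AM-GM in the form [p * q <= ((p + q) / 2) ^+ 2]. *)
  rewrite /A -/p; set q := 6 / t * _.
  have := sqr_ge0 (p - q); nra.
- move=> hD; suff: `|x u v| <= N by lra.
  rewrite xE; have /(ler_wpM2l (ltW (mulr_gt0 w00 w0v))) := hD.
  move/le_trans; apply.
  have -> : w u * w v * (rho u v ^+ 2 * a v) = (w u * rho u v) * (w v * rho u v * a v).
    by ring.
  by rewrite rE le_eqVlt; apply/orP; left; apply/eqP; rewrite /N; ring.
- rewrite -/(m u v) -/(cost u v) -/(theta u) => hD; suff: `|x u v| <= P by lra.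
  rewrite xE /P.
  have -> : w u * w v * `|e u v - m u v| =
     sd * w u ^+ 2 / theta u * (rho u v * theta u * `|e u v - m u v|).
    have -> : w v = sd * (w u * rho u v) by rewrite rE mulrCA divff ?mulr1 // gt_eqF.
    by field; lra.
  have -> : 20 * sd * w u ^+ 2 / theta u * cost u v =
     sd * w u ^+ 2 / theta u * (20 * cost u v) by ring.
  exact: ler_wpM2l.
Qed.

(** [edge_loss] is summed over the neighbours: the assumption bounds the total cost, [W] the total
    weight. [entropy_weight_split] with [al = a u / n] turns the AM-GM terms into the last summand
    of [lam]. *)
Let vertex_loss (S : {set V}) u : u \in S ->
  \sum_(v in S | G u v) cost u v < 3 / 10 * L * (a u * theta u) ->
  `|\sum_(v in S | G u v) x u v| <= lam u.
Proof.
move=> uS hc; have th1 := theta1 u; have b00 := b0 u.1.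
case: (a_bnd u) => [au|/andP[au aun]].
  rewrite big1 ?normr0 // => v /andP[_ guv]; have [e0 eu ev] := e_bnd guv.
  have e00 : e u v = 0 by apply/eqP; rewrite eq_le e0 andbT -au.
  by rewrite /x /m e00 au !mul0r subr0 mulr0.
have sub v : (v \in S) && G u v -> adj u.1 v.1 by case/andP=> _ /andP[].
(* If [b] vanishes, all classes on neighbouring fibres are empty. The case is separate because [b]
   is in the denominator of [t]. *)
move: (b00); rewrite le_eqVlt => /orP[/eqP bz|bp].
  have WE : W u.1 = 0 by rewrite b2 -bz expr0n mulr0.
  rewrite big1 ?normr0 // => v hv; have [e0 eu ev] := e_bnd (proj2 (andP hv)).
  have av : a v = 0.
    move/eqP: WE; rewrite psumr_eq0 // => /allP /(_ v).
    rewrite mem_index_enum (sub _ hv) => /(_ isT); rewrite mulf_eq0 expf_eq0 /=.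
    by rewrite gt_eqF //= => /eqP.
  have e00 : e u v = 0 by apply/eqP; rewrite eq_le e0 andbT -av.
  by rewrite /x /m e00 av mulr0 mul0r subr0 mulr0.
pose y : R := Num.sqrt (theta u).
have y2 : y ^+ 2 = theta u by rewrite sqr_sqrtr //; lra.
have y0 : 0 < y by rewrite sqrtr_gt0; lra.
have L20' := L20; set s := 3 / 10 * L; have s0 : 0 < s by rewrite /s; lra.
(* This [t] balances the two sides of the AM-GM bound in [edge_loss]. *)
pose t := s * y / (w u * b u.1 * sd).
have t0 : 0 < t by apply: divr_gt0; repeat apply: mulr_gt0 => //.
apply: le_trans (ler_norm_sum _ _ _) _.
have hloss v (hv : (v \in S) && G u v) := edge_loss au (proj2 (andP hv)) t0.
apply: le_trans (ler_sum _ hloss) _.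
rewrite !big_split /= -!mulr_sumr big_split /= -!mulr_sumr.
set C := \sum_(v in S | G u v) cost u v in hc *.
have leW : \sum_(v in S | G u v) w v ^+ 2 * a v <= W u.1.
  rewrite /W big_mkcond [X in _ <= X]big_mkcond /=; apply: ler_sum => v _.
  by case: ifP => [/sub ->//|_]; case: ifP.
have leN : \sum_(v in S | G u v) w v ^+ 2 * a v * rho u v <=
           \sum_(v | G u v) w v ^+ 2 * a v * rho u v.
  rewrite big_mkcond [X in _ <= X]big_mkcond /=; apply: ler_sum => v _.
  have ? : 0 <= w v ^+ 2 * a v * rho u v by apply: mulr_ge0 => //; exact: ltW.
  by case: (v \in S) => /=; case: ifP.
rewrite /lam addrAC [X in _ <= X]addrAC; apply: lerD; last first.
  by rewrite ler_pM2l ?invr_gt0.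
rewrite [X in _ <= X]addrC; apply: lerD; last first.
  (* Here [20 * (3 / 10)] gives the coefficient [6] in [lam]. *)
  have h1 : 0 <= 20 * sd * w u ^+ 2 / theta u.
    have th0 : 0 <= theta u by lra.
    by nonneg.
  apply: le_trans (ler_wpM2l h1 (ltW hc)) _.
  by rewrite le_eqVlt; apply/orP; left; apply/eqP; field; lra.
have al : 0 < a u / n <= 1 by rewrite divr_gt0 //= ler_pdivrMr // mul1r.
have := entropy_weight_split al (w0 u) b00; rewrite invf_div -/(theta u) -/y.
set mn := Num.min _ _ => hew.
have key : s * sd * n * (a u / n * y * w u * b u.1) <=
   s * sd * (w u ^+ 2 * a u + 4 * n * mn).
  have -> : s * sd * (w u ^+ 2 * a u + 4 * n * mn) =
     s * sd * n * (a u / n * w u ^+ 2 + 4 * mn) by field; rewrite gt_eqF.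
  by apply: ler_wpM2l => //; nonneg.
apply: le_trans key.
set r := s * sd * n * _.
suff [h1 h2] : t * w u ^+ 2 * (a u / n) * (\sum_(v in S | G u v) w v ^+ 2 * a v) <= r
  /\ 6 / t * C <= r by lra.
split.
  apply: le_trans (_ : t * w u ^+ 2 * (a u / n) * W u.1 <= _).
    by apply: ler_wpM2l => //; nonneg.
  rewrite b2 -sd2 le_eqVlt; apply/orP; left; apply/eqP.
  by rewrite /t /r; field; rewrite !gt_eqF.
apply: le_trans (_ : 6 / t * (s * (a u * theta u)) <= _).
  by apply: ler_wpM2l; [rewrite divr_ge0 // ltW | exact: ltW].
have -> : 6 / t * (s * (a u * theta u)) = 6 * (a u * y * w u * b u.1 * sd).
  by rewrite -y2 /t; field; rewrite !gt_eqF.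
have -> : r = s * (a u * y * w u * b u.1 * sd) by rewrite /r; field; rewrite gt_eqF.
apply: ler_wpM2r; first by nonneg.
(* [s = 3 / 10 * L] is at least [6] because [L >= 20]. *)
by rewrite /s; lra.
Qed.

Let sum_adj (F : 'I_h -> R) :
  \sum_i \sum_(j | adj i j) F j = d%:R * \sum_j F j.
Proof.
rewrite (exchange_big_dep predT) //= mulr_sumr; apply: eq_bigr => j _.
under eq_bigl => i do rewrite adj_sym.
by rewrite sumr_const -(adj_deg j) cardsE mulr_natl.
Qed.

Let sumW : \sum_i W i <= 10 * d%:R.
Proof.
have -> : \sum_i W i = \sum_i \sum_(j | adj i j) \sum_(k < K) w (j, k) ^+ 2 * a (j, k).
  by apply: eq_bigr => i _; rewrite pair_big_dep /=; apply: eq_big => [[j k]|[j k] _] //=;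
     rewrite andbT.
rewrite sum_adj pair_bigA /= mulrC.
have -> : \sum_(p : V) w (p.1, p.2) ^+ 2 * a (p.1, p.2) = \sum_u w u ^+ 2 * a u.
  by apply: eq_bigr => -[].
by rewrite ler_pM2r.
Qed.

(** Edges require [w u > M = w v / sd], and [rho u v = M / w u]; on each of the [d] fibres adjacent
    to that of [v] this is a geometric series with sum at most [2]. *)
Let rho_sum v : \sum_(u | G u v) rho u v <= 2 * d%:R.
Proof.
pose M := w v / sd; have M0 : 0 < M by rewrite divr_gt0.
apply: le_trans (_ : \sum_(i | adj v.1 i) \sum_(k < K)
   M * (if M <= 2 ^+ k * c then (2 ^+ k * c)^-1 else 0) <= _).
  rewrite pair_big_dep /= big_mkcond [X in _ <= X]big_mkcond /=.
  apply: ler_sum => -[i k] _ /=; rewrite andbT /G /= adj_sym.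
  case: (adj v.1 i) => //=; have wk := w0 (i, k); rewrite /w /= in wk.
  have q0 : 0 <= M * (2 ^+ k * c)^-1 by rewrite mulr_ge0 ?invr_ge0 // ltW.
  case: ifP => [/andP[h1 _]|_]; last by case: ifP; rewrite ?mulr0.
  rewrite ifT; last first.
    rewrite /M ler_pdivrMr //; rewrite ltr_pdivlMr // mulrC ltr_pdivrMr // in h1.
    exact: ltW.
  by rewrite /rho /M le_eqVlt; apply/orP; left; apply/eqP; rewrite /w /=; field;
     rewrite !gt_eqF ?exprn_gt0 ?(c0 v.1).
apply: le_trans (_ : \sum_(i | adj v.1 i) 2 <= _).
  apply: ler_sum => i _; rewrite -mulr_sumr.
  apply: le_trans (ler_wpM2l (ltW M0) (dyadic_sum_above K (c0 v.1) M0)) _.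
  by rewrite mulrCA divff ?mulr1 // gt_eqF.
by rewrite sumr_const -(adj_deg v.1) cardsE mulr_natr.
Qed.

(** The three summands contribute at most [60 L sd], [20 sd <= L sd] and
    [3 / 10 * (10 + 160) L sd = 51 L sd]. *)
Let lam_sum : \sum_u lam u <= 150 * L * sd.
Proof.
rewrite /lam !big_split /= -!mulr_sumr big_split /= -mulr_sumr.
have weight' := weight; set q := \sum_u w u ^+ 2 * a u in weight' *.
have L20' := L20; have L0 : 0 <= L by lra.
have h1 : 6 * L * sd * q <= 6 * L * sd * 10.
  by apply: ler_wpM2l => //; nonneg.
have h2 : sd^-1 * (\sum_u \sum_(v | G u v) w v ^+ 2 * a v * rho u v) <= 20 * sd.
  rewrite (exchange_big_dep predT) //=.
  apply: le_trans (_ : sd^-1 * (\sum_v w v ^+ 2 * a v * (2 * d%:R)) <= _).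
    rewrite ler_pM2l ?invr_gt0 //; apply: ler_sum => v _.
    by rewrite -mulr_sumr; apply: ler_wpM2l.
  rewrite -mulr_suml -/q -sd2.
  have -> : sd^-1 * (q * (2 * sd ^+ 2)) = 2 * sd * q by field; rewrite gt_eqF.
  have := ler_wpM2l (ltW sd0) weight'; lra.
have h3 : \sum_u Num.min (w u * b u.1) (b u.1 ^+ 3 / w u) <= 40 / n.
  rewrite -(pair_bigA _ (fun i k => Num.min (w (i, k) * b i) (b i ^+ 3 / w (i, k)))) /=.
  apply: le_trans (_ : \sum_i 4 * b i ^+ 2 <= _).
    by apply: ler_sum => i _; exact: dyadic_sum_min (c0 i) (b0 i).
  rewrite -mulr_sumr ler_pdivlMr //.
  have : (\sum_i b i ^+ 2) * (d%:R * n) <= 10 * d%:R.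
    rewrite mulr_suml; apply: le_trans sumW; apply: ler_sum => i _.
    by rewrite b2 mulrC.
  by rewrite mulrCA [10 * _]mulrC ler_pM2l //; lra.
have h4 : 4 * n * (\sum_u Num.min (w u * b u.1) (b u.1 ^+ 3 / w u)) <= 160.
  have := ler_wpM2l (ltW n0) h3; rewrite [n * (40 / n)]mulrCA divff ?gt_eqF //.
  lra.
have h5 := ler_wpM2l (ltW (mulr_gt0 (_ : 0 < L) sd0)) (lerD weight h4).
have {}h5 := h5 ltac:(lra).
have h6 := ler_wpM2r (ltW sd0) L20.
move: h1 h2 h4 h5 h6; rewrite -/q.
move: (\sum_u Num.min _ _) (sd^-1 * _) => z1 z2; have sd0' := sd0; lra.
Qed.

(** The double sums run over ordered pairs and are twice the potency, hence the factor [2] at the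
    loss. *)
Lemma selection : exists S : {set V},
  `|\sum_u \sum_(v | G u v) x u v| - 2 * (150 * L * sd)
     <= `|\sum_(u in S) \sum_(v in S | G u v) x u v| /\
  forall u, u \in S ->
    3 / 10 * L * (a u * theta u) <= \sum_(v in S | G u v) cost u v.
Proof.
have Gsym u v : G u v = G v u.
  have inv (z : R) : 0 < z -> (sd^-1 < z) = (z^-1 < sd).
    by move=> z0; rewrite -{1}(invrK z) ltf_pV2 ?posrE ?invr_gt0.
  rewrite /G adj_sym (inv _ (divr_gt0 (w0 u) (w0 v))) (inv _ (divr_gt0 (w0 v) (w0 u))).
  by rewrite !invf_div; congr (_ && _); rewrite andbC.
have Girr u : ~~ G u u by rewrite /G (negbTE (adj_irr _)).
have xsym u v : G u v -> x u v = x v u.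
  by move=> guv; rewrite /x /m (e_sym guv) [w u * _]mulrC [a u * _]mulrC.
have [S [h1 h2]] := prune Gsym Girr xsym lam0 vertex_loss.
exists S; split => //; apply: le_trans h1.
have -> : \sum_(u in [set: V]) \sum_(v in [set: V] | G u v) x u v
        = \sum_u \sum_(v | G u v) x u v.
  apply: eq_big => [u|u _]; first by rewrite inE.
  by apply: eq_bigl => v; rewrite inE.
by rewrite lerD2l lerN2 ler_pM2l.
Qed.

End Selection.

(** * Elementary Stirling bounds *)

Section Stirling.
Variable R : realType.

(* Equal to [1] at [k = 0], asymptotic to [sqrt (2 pi k)]. *)
Definition stirling (k : nat) : R := k`!%:R * expR k%:R / k%:R ^+ k.

Lemma stirling_gt0 k : 0 < stirling k.
Proof.
apply: divr_gt0; first by rewrite mulr_gt0 ?expR_gt0 // ltr0n fact_gt0.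
by case: k => [|k]; rewrite ?expr0 // exprn_gt0 // ltr0n.
Qed.

Lemma stirlingS k : stirling k.+1 * k.+1%:R ^+ k = stirling k * k%:R ^+ k * expR 1.
Proof.
have kk : k%:R ^+ k != 0 :> R.
  by case: k => [|k]; rewrite ?expr0 ?oner_eq0 // expf_neq0 // pnatr_eq0.
have k1 : k.+1%:R != 0 :> R by rewrite pnatr_eq0.
have k1k : k.+1%:R ^+ k != 0 :> R by rewrite expf_neq0.
rewrite /stirling factS natrM divfK // exprS -[in expR _]natr1 expRD.
move: (k.+1%:R) k1 k1k => z z1 zk; field.
by rewrite z1 zk.
Qed.

(** For [k > 0] the ratio of consecutive values is [e / (1 + 1 / k) ^ k], which is at least [1]. *)
Lemma stirling_leS k : stirling k <= stirling k.+1.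
Proof.
have k1k : 0 < k.+1%:R ^+ k :> R by rewrite exprn_gt0 // ltr0n.
rewrite -(ler_pM2r k1k) stirlingS -mulrA ler_pM2l ?stirling_gt0 //.
case: k k1k => [|k] _; first by rewrite !expr0 mul1r ltW // expR_gt1.
have k0 : 0 < k.+1%:R :> R by rewrite ltr0n.
have -> : k.+2%:R = k.+1%:R * (1 + k.+1%:R^-1) :> R.
  by rewrite mulrDr mulr1 divff ?gt_eqF // natr1.
rewrite exprMn ler_pM2l ?exprn_gt0 //.
apply: le_trans (_ : expR k.+1%:R^-1 ^+ k.+1 <= _).
  by apply: lerXn2r; rewrite ?nnegrE ?expR_ge0 ?expR_ge1Dx // addr_ge0 // invr_ge0 ltW.
by rewrite -expRM_natr mulVf // gt_eqF.
Qed.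

Lemma stirling_le : {homo stirling : k l / (k <= l)%N >-> k <= l}.
Proof.
by apply: homo_leq => [k|k l m|k];
  [exact: lexx | exact: le_trans | exact: stirling_leS].
Qed.

Lemma stirling0 : stirling 0 = 1.
Proof. by rewrite /stirling fact0 expR0 expr0 mulr1 divr1. Qed.

Lemma stirling_linear k : (0 < k)%N -> stirling k <= expR 1 * k%:R.
Proof.
case: k => // k _; elim: k => [|k IH].
  by rewrite /stirling expr1 divr1 mul1r mulr1.
have k0 : 0 < k.+1%:R :> R by rewrite ltr0n.
have k2 : 0 < k.+2%:R :> R by rewrite ltr0n.
rewrite -(ler_pM2r (exprn_gt0 k.+1 k2)) stirlingS.
apply: le_trans (_ : expR 1 * k.+1%:R * k.+1%:R ^+ k.+1 * expR 1 <= _).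
  by rewrite !ler_pM2r ?expR_gt0 // exprn_gt0.
rewrite -!mulrA ler_pM2l ?expR_gt0 // mulrA -!exprS.
(* [e <= (1 + 1/k)^(k+1)] via [exp(-1/(k+1)) >= k/(k+1)]. *)
have h : k.+1%:R / k.+2%:R <= expR (- (k.+2%:R)^-1) :> R.
  apply: le_trans (expR_ge1Dx _); rewrite ler_pdivrMr // mulrDl mulNr mulVf ?gt_eqF //.
  by rewrite mul1r -(natr1 k.+1); lra.
have h2 : (k.+1%:R / k.+2%:R) ^+ k.+2 <= (expR 1)^-1 :> R.
  apply: le_trans (_ : expR (- (k.+2%:R)^-1) ^+ k.+2 <= _).
    by apply: lerXn2r => //; rewrite nnegrE ?expR_ge0 // divr_ge0 // ltW.
  by rewrite -expRM_natr mulNr mulVf ?gt_eqF // expRN.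
move: h2; rewrite expr_div_n ler_pdivrMr ?exprn_gt0 // mulrC.
by rewrite ler_pdivlMr ?expR_gt0.
Qed.

End Stirling.

(** * Counting permutations that induce a given colouring *)

Section Fibres.
Variables (T J : finType) (col : T -> J).

(** A colour-preserving permutation is determined by its restrictions to the colour classes. *)
Lemma card_perm_stab : (#|[set s : {perm T} | [forall j, col (s j) == col j]]|
  <= \prod_l #|[set j | col j == l]|`!)%N.
Proof.
pose B l := [set j | col j == l].
pose f (s : {perm T}) := [ffun l : J => restr_perm (B l) s].
pose F l := perm_on (B l).
have -> : (\prod_l #|[set j | col j == l]|`! = #|family F|)%N.
  rewrite card_family foldrE big_image /=.
  by apply: eq_bigr => l _; rewrite /F -card_Sym; apply: eq_card => s; rewrite !inE.
set St := [set s | _].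
have stab s l : s \in St -> s \in ('N(B l | 'P))%g.
  rewrite inE => /forallP h; apply/astabsP => j /=.
  by rewrite !inE apermE (eqP (h j)).
rewrite -(@card_in_imset _ _ f St); last first.
  move=> s t hs ht /ffunP fst; apply/permP => j.
  have := fst (col j); rewrite !ffunE => /permP /(_ j).
  by rewrite !restr_permE ?stab // inE.
apply/subset_leq_card/subsetP => _ /imsetP[s _ ->].
by apply/familyP => l; rewrite ffunE; exact: restr_perm_on.
Qed.

(** Multiplying by the inverse of one solution maps all solutions into the stabiliser of the
    colours. *)
Lemma card_perm_colouring (g : T -> J) :
  (#|[set s : {perm T} | [forall j, col (s j) == g j]]|
  <= \prod_l #|[set j | col j == l]|`!)%N.
Proof.
have [->|[s0 s0P]] := set_0Vmem [set s : {perm T} | [forall j, col (s j) == g j]].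
  by rewrite cards0.
apply: leq_trans card_perm_stab.
rewrite -(card_imset _ (mulgI s0^-1%g)).
apply/subset_leq_card/subsetP => _ /imsetP[s sP ->]; rewrite inE.
move: s0P sP; rewrite !inE => /forallP h0 /forallP h.
apply/forallP => j; rewrite permM (eqP (h _)) -(eqP (h0 _)).
by rewrite permKV.
Qed.

End Fibres.

(** * Permutations with a prescribed contingency table *)

Section Table.
Variables (R : realType) (T I J : finType) (row : T -> I) (col : T -> J).
Variables (G : I -> J -> bool) (e : I -> J -> nat).

Let A k := #|[set j | row j == k]|.
Let B l := #|[set j | col j == l]|.
Let table (g : T -> J) k l := #|[set j | (row j == k) && (g j == l)]|.
Let p l : R := (B l)%:R / #|T|%:R.
Let m k l : R := (A k)%:R * (B l)%:R / #|T|%:R.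

(** The candidates for [col \o s] with [s] a permutation, which always has the colour profile of
    [col]. *)
Definition colourings : {set {ffun T -> J}} :=
  [set g : {ffun T -> J} | [forall l, #|[set j | g j == l]| == B l] &&
    [forall k, forall l, G k l ==> (table g k l == e k l)]].

Hypothesis T0 : (0 < #|T|)%N.

Let n0 : 0 < #|T|%:R :> R. Proof. by rewrite ltr0n. Qed.

Let sumB : (\sum_l B l = #|T|)%N.
Proof.
rewrite -sum1_card (partition_big col predT) //=; apply: eq_bigr => l _.
by rewrite sum1_card /B; apply: eq_card => j; rewrite !inE.
Qed.

Let sump : \sum_l p l = 1.
Proof. by rewrite -mulr_suml -natr_sum sumB divff // gt_eqF. Qed.

Let p0 l : 0 <= p l. Proof. by rewrite divr_ge0 // ler0n. Qed.

(* Chernoff bound for independent colours of law [p], tilted by [e / m] on the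
   cells of [G]; conditioning on the colour profile costs the factor
   [prod p ^+ B]. *)
Lemma card_colourings :
  #|colourings|%:R * \prod_l p l ^+ B l
    <= expR (- \sum_k \sum_(l | G k l) poisson_cost (e k l)%:R (m k l)).
Proof.
have [->|[g0 g0P]] := set_0Vmem colourings.
  by rewrite cards0 mul0r expR_ge0.
(* A single colouring with this table shows that [e] vanishes where [m] does, so the tilt [e / m] is
   harmless at [m = 0]. *)
have me k l : G k l -> m k l = 0 -> e k l = 0%N.
  move=> Gkl /eqP; rewrite !mulf_eq0 invr_eq0 (gt_eqF n0) orbF !pnatr_eq0.
  move: g0P; rewrite inE => /andP[/forallP /(_ l) /eqP gB].
  move=> /forallP /(_ k) /forallP /(_ l) /implyP /(_ Gkl) /eqP <- h.
  apply/eqP; rewrite -leqn0; case/orP: h => /eqP <-; last rewrite -gB.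
    by apply/subset_leq_card/subsetP => j; rewrite !inE => /andP[].
  by apply/subset_leq_card/subsetP => j; rewrite !inE => /andP[].
pose z k l : R := if G k l then (e k l)%:R / m k l else 1.
have m0 k l : 0 <= m k l by rewrite divr_ge0 ?mulr_ge0 ?ler0n.
have z0 k l : 0 <= z k l by rewrite /z; case: ifP => // _; rewrite divr_ge0 ?ler0n.
have upper : \sum_(g : {ffun T -> J}) \prod_j (p (g j) * z (row j) (g j))
    <= expR (\sum_k \sum_(l | G k l) ((e k l)%:R - m k l)).
  rewrite -(bigA_distr_bigA (fun j l => p l * z (row j) l)) /=.
  apply: le_trans (_ : \prod_j expR (\sum_l p l * (z (row j) l - 1)) <= _).
    apply: ler_prod => j _; apply/andP; split.
      by apply: sumr_ge0 => l _; exact: mulr_ge0.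
    apply: le_trans (expR_ge1Dx _); rewrite -[X in X + _]sump -big_split /=.
    by apply: ler_sum => l _; rewrite mulrBr mulr1 addrC subrK.
  rewrite -expR_sum (partition_big row predT) //= le_eqVlt; apply/orP; left.
  apply/eqP; congr expR; apply: eq_bigr => k _.
  rewrite (eq_bigr (fun=> \sum_l p l * (z k l - 1))) => [|j /eqP -> //].
  rewrite sumr_const -mulr_natl [RHS]big_mkcond mulr_sumr /=.
  have -> : #|[pred i | row i == k]| = A k.
    by apply: eq_card => j; rewrite !inE.
  apply: eq_bigr => l _; rewrite /z; case: ifP => Gkl; last by rewrite subrr !mulr0.
  have [mz|mz] := eqVneq (m k l) 0.
    rewrite mz me // mul0r !sub0r oppr0 mulrN1 mulrN mulrA.
    by rewrite -/(m k l) mz oppr0.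
  rewrite -[in RHS](divfK mz (e k l)%:R) /p mulrA mulrA -/(m k l).
  by rewrite mulrBr mulr1 mulrC.
(* The weight is constant on [colourings]: it depends only on the profile and the prescribed
   entries. *)
have lower g : g \in colourings ->
   \prod_j (p (g j) * z (row j) (g j)) = \prod_l p l ^+ B l *
     expR (\sum_k \sum_(l | G k l) (e k l)%:R * ln ((e k l)%:R / m k l)).
  rewrite inE => /andP[/forallP gB /forallP gT]; rewrite big_split /=; congr (_ * _).
    rewrite (partition_big g predT) //=; apply: eq_bigr => l _.
    rewrite (eq_bigr (fun=> p l)) => [|j /eqP -> //].
    rewrite prodr_const -(eqP (gB l)); congr (_ ^+ _).
    by apply: eq_card => j; rewrite !inE.
  rewrite expR_sum (partition_big row predT) //=; apply: eq_bigr => k _.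
  rewrite expR_sum (partition_big g predT) //= [RHS]big_mkcond /=.
  apply: eq_bigr => l _.
  rewrite (eq_bigr (fun=> z k l)) => [|j /andP[/eqP -> /eqP ->] //].
  rewrite prodr_const.
  have -> : #|[pred i | (row i == k) && (g i == l)]| = table g k l.
    by apply: eq_card => j; rewrite !inE.
  have /forallP /(_ l) /implyP := gT k; rewrite /z.
  case: ifP => [Gkl /(_ isT) /eqP ->|_ _]; last by rewrite expr1n.
  have [->|ez] := posnP (e k l); first by rewrite expr0 mul0r expR0.
  rewrite expRM_natl lnK // posrE divr_gt0 ?ltr0n // lt_def m0 andbT.
  by apply/eqP => /(me _ _ Gkl) h; rewrite h in ez.
have : \sum_(g in colourings) \prod_j (p (g j) * z (row j) (g j))
    <= expR (\sum_k \sum_(l | G k l) ((e k l)%:R - m k l)).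
  apply: le_trans upper; rewrite big_mkcond /=; apply: ler_sum => g _.
  case: ifP => // _; apply: prodr_ge0 => j _; exact: mulr_ge0.
rewrite (eq_bigr _ lower) sumr_const -[X in X <= _]mulr_natl mulrA -ler_pdivlMr ?expR_gt0 //.
rewrite -expRB => /le_trans; apply; rewrite ler_expR -sumrB -sumrN.
apply: ler_sum => k _; rewrite -sumrB -sumrN; apply: ler_sum => l _.
rewrite /poisson_cost; lra.
Qed.

(** The permutations are grouped by [col \o s]; each colouring arises at most as often as the
    product of the factorials of the [B l]. Divided by [\prod_l p l ^+ B l], this product is the
    factorial of [#|T|] times a quotient of Stirling factors. *)
Lemma card_perm_table :
  #|[set s : {perm T} | [forall k, forall l,
      G k l ==> (table (fun j => col (s j)) k l == e k l)]]|%:R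
  <= #|T|`!%:R * (\prod_l stirling R (B l) / stirling R #|T|) *
     expR (- \sum_k \sum_(l | G k l) poisson_cost (e k l)%:R (m k l)) :> R.
Proof.
set D := [set s | _].
pose f (s : {perm T}) : {ffun T -> J} := [ffun j => col (s j)].
have fD s : s \in D -> f s \in colourings.
  rewrite !inE => /forallP h; apply/andP; split.
    apply/forallP => l; rewrite /B -(card_preimset [set j | col j == l] (@perm_inj _ s)).
    by apply/eqP/eq_card => j; rewrite !inE ffunE.
  apply/forallP => k; apply/forallP => l; have /forallP /(_ l) := h k.
  case: (G k l) => //= /eqP <-; apply/eqP/eq_card => j.
  by rewrite !inE ffunE.
have step : (#|D| <= #|colourings| * \prod_l (B l)`!)%N.
  rewrite -sum1_card (partition_big f (mem colourings)) //= -sum_nat_const.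
  apply: leq_sum => g _; rewrite sum1_card.
  apply: leq_trans (card_perm_colouring col g); apply/subset_leq_card/subsetP => s.
  by rewrite !inE => /andP[_ /eqP <-]; apply/forallP => j; rewrite ffunE.
have pB : 0 < \prod_l p l ^+ B l.
  apply: prodr_gt0 => l _; rewrite /p; case: (B l) => [|b]; first by rewrite expr0.
  by rewrite exprn_gt0 // divr_gt0 // ltr0n.
have E : #|T|`!%:R * (\prod_l stirling R (B l) / stirling R #|T|) =
   (\prod_l (B l)`!)%N%:R / \prod_l p l ^+ B l.
  have -> : \prod_l p l ^+ B l = \prod_l (B l)%:R ^+ B l / #|T|%:R ^+ #|T| :> R.
    have -> : #|T|%:R ^+ #|T| = \prod_l #|T|%:R ^+ B l :> R by rewrite prodrXr sumB.
    rewrite -prodfV -big_split /=; apply: eq_bigr => l _.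
    by rewrite /p expr_div_n.
  have -> : \prod_l stirling R (B l) =
     (\prod_l (B l)`!)%N%:R * expR #|T|%:R / \prod_l (B l)%:R ^+ B l.
    rewrite -sumB natr_sum expR_sum natr_prod -prodfV -!big_split /=.
    by apply: eq_bigr => l _.
  have Bn : \prod_l (B l)%:R ^+ B l != 0 :> R.
    apply/prodf_neq0 => l _; case: (B l) => [|b]; rewrite ?expr0 ?oner_eq0 //.
    by rewrite expf_neq0 // pnatr_eq0.
  have Tf : #|T|`!%:R != 0 :> R by rewrite pnatr_eq0 -lt0n fact_gt0.
  have Tn : #|T|%:R ^+ #|T| != 0 :> R by rewrite expf_neq0 // gt_eqF.
  have Te : expR #|T|%:R != 0 :> R by rewrite gt_eqF // expR_gt0.
  rewrite /stirling; move: (expR _) (_ ^+ #|T|) (#|T|`!%:R) Te Tn Tf => x y u hx hy hu.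
  move: (\prod_l (B l)%:R ^+ B l) Bn => v hv.
  by field; rewrite hx hy hu hv.
rewrite E mulrAC ler_pdivlMr //.
apply: le_trans (_ : (#|colourings| * \prod_l (B l)`!)%N%:R * \prod_l p l ^+ B l <= _).
  by rewrite ler_pM2r // ler_nat.
rewrite natrM mulrAC [X in _ <= X]mulrC; apply: ler_wpM2r; first exact: ler0n.
exact: card_colourings.
Qed.

End Table.

Lemma big_option (S : Type) (idx : S) (op : Monoid.com_law idx) (I : finType)
    (F : option I -> S) :
  \big[op/idx]_o F o = op (F None) (\big[op/idx]_i F (Some i)).
Proof.
rewrite (bigD1 None) //=; congr (op _ _).
rewrite (reindex_omap Some id) /=; last by case.
by apply: eq_bigl => i; rewrite eqxx.
Qed.

(** * Permutations with prescribed edge counts between disjoint classes *)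

Section Classes.
Variables (R : realType) (T I J : finType) (A : I -> {set T}) (B : J -> {set T}).
Variables (G : I -> J -> bool) (e : I -> J -> nat).
Hypothesis T0 : (0 < #|T|)%N.
Hypothesis trivA : forall k k', k != k' -> [disjoint A k & A k'].
Hypothesis trivB : forall l l', l != l' -> [disjoint B l & B l'].

(** The colour [None] collects the points outside all classes and carries no constraint. Its
    Stirling factor is at most that of [#|T|], the denominator in [card_perm_table]. *)
Lemma card_perm_classes :
  #|[set s : {perm T} | [forall k, forall l,
      G k l ==> (#|[set j in A k | s j \in B l]| == e k l)]]|%:R
  <= #|T|`!%:R * \prod_l stirling R #|B l| *
     expR (- \sum_k \sum_(l | G k l)
       poisson_cost (e k l)%:R (#|A k|%:R * #|B l|%:R / #|T|%:R)) :> R.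
Proof.
have pickE (L : finType) (C : L -> {set T}) j l :
    (forall k k', k != k' -> [disjoint C k & C k']) ->
    ([pick k | j \in C k] == Some l) = (j \in C l).
  move=> tr; case: pickP => [k jk|->] //; apply/eqP/idP => [[<-]//|jl].
  apply/eqP; apply: contraT => /tr /pred0P /(_ j) /=.
  by rewrite jk jl.
pose row j := [pick k | j \in A k]; pose col j := [pick l | j \in B l].
pose G' k l := if k is Some k then if l is Some l then G k l else false else false.
pose e' k l := if k is Some k then if l is Some l then e k l else 0%N else 0%N.
have cA k : #|[set j | row j == Some k]| = #|A k|.
  by apply: eq_card => j; rewrite !inE pickE.
have cB l : #|[set j | col j == Some l]| = #|B l|.
  by apply: eq_card => j; rewrite !inE pickE.
have := card_perm_table R row col G' e' T0.
set D := [set s | _]; set D' := [set s | _].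
have -> : D = D'.
  apply/setP => s; rewrite !inE; apply/forallP/forallP => h.
    move=> k; apply/forallP => l; have /forallP /(_ (Some l)) := h (Some k).
    rewrite /=; case: (G k l) => //= /eqP <-; apply/eqP/eq_card => j.
    by rewrite !inE !pickE.
  move=> [k|]; last by apply/forallP.
  apply/forallP => -[l|] //; have /forallP /(_ l) := h k.
  rewrite /=; case: (G k l) => //= /eqP <-; apply/eqP/eq_card => j.
  by rewrite !inE !pickE.
move/le_trans; apply.
rewrite big_option /= [X in expR (- X)]big_option /=.
rewrite [X in expR (- (X + _))]big_pred0 // add0r.
under [X in expR (- X)]eq_bigr => k _.
  rewrite big_mkcond big_option /= add0r -big_mkcond cA.
  under eq_bigr => l _ do rewrite cB.
  over.
rewrite ler_pM2r ?expR_gt0 // ler_pM2l ?ltr0n ?fact_gt0 //.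
rewrite ler_pdivrMr ?stirling_gt0 // mulrC.
under eq_bigr => l _ do rewrite cB.
apply: ler_wpM2l; first by apply: prodr_ge0 => l _; rewrite ltW ?stirling_gt0.
by apply: stirling_le; exact: max_card.
Qed.

End Classes.

Lemma decPP (P : Prop) : reflect P (decP P).
Proof. by rewrite /decP; case: ClassicalEpsilon.excluded_middle_informative => h; constructor. Qed.

(** * Binomial coefficients against entropy and Stirling factors *)

Section Binomials.
Variable R : realType.

Lemma bin_ge_expn2 n k : (k.*2 <= n)%N -> (2 ^ k <= 'C(n, k))%N.
Proof.
elim: k n => [|k IH] [|n] //; rewrite ?bin0 // doubleS ltnS => kn.
rewrite -(leq_pmul2l (ltn0Sn k)) -mul_bin_diag expnS mulnA.
by apply: leq_mul; [rewrite mulnC mul2n doubleS | exact/IH/ltnW].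
Qed.

(** One term of the expansion of [(1 + a / n) ^ n <= exp a] bounds ['C(n, k) (a / n) ^ k]. Allowing
    [k <= a] covers the truncated coefficients too. *)
Lemma bin_le_entropy n k (a : nat) : (0 < a <= n)%N -> (k <= a)%N ->
  'C(n, k)%:R <= expR (a%:R * (1 + ln (n%:R / a%:R))) :> R.
Proof.
move=> /andP[a0 an] ka.
have a0' : 0 < a%:R :> R by rewrite ltr0n.
have n0 : 0 < n%:R :> R by rewrite ltr0n (leq_trans a0).
set X : R := n%:R / a%:R; have X1 : 1 <= X by rewrite ler_pdivlMr // mul1r ler_nat.
have X0 : 0 < X by lra.
have -> : expR (a%:R * (1 + ln X)) = expR a%:R * X ^+ a.
  by rewrite mulrDr mulr1 expRD expRM_natl lnK ?posrE.
have [kn|kn] := leqP k n; last first.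
  by rewrite bin_small // mulr_ge0 ?expR_ge0 // exprn_ge0 // ltW.
apply: le_trans (_ : expR a%:R * X ^+ k <= _); last first.
  by rewrite ler_pM2l ?expR_gt0 // ler_weXn2l.
rewrite -ler_pdivrMr ?exprn_gt0 // -exprVn.
apply: le_trans (_ : (1 + X^-1) ^+ n <= _).
  rewrite exprDn (bigD1 (inord k)) //= inordK ?ltnS // expr1n mul1r.
  rewrite mulr_natl lerDl; apply: sumr_ge0 => i _; rewrite expr1n mul1r.
  by rewrite mulrn_wge0 // exprn_ge0 // invr_ge0 ltW.
apply: le_trans (_ : expR X^-1 ^+ n <= _).
  by apply: lerXn2r; rewrite ?nnegrE ?expR_ge0 ?expR_ge1Dx // addr_ge0 // invr_ge0 ltW.
rewrite -expRM_natr le_eqVlt; apply/orP; left; apply/eqP; congr expR.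
by rewrite /X; field; rewrite !gt_eqF.
Qed.

Lemma stirling_ge1 k : 1 <= stirling R k.
Proof. by rewrite -(stirling0 R); exact: stirling_le. Qed.

(** The left side is polynomial in [a <= 2 k + 1], the binomial coefficient at least [2 ^ k]. Thus
    one extra binomial absorbs the Stirling factors of a class. *)
Lemma stirling_exp_le_bin d n a : (0 < d)%N -> (0 < a <= n)%N ->
  stirling R a ^+ d <= (4 * d%:R * expR 1) ^+ d * 'C(n, minn a n./2)%:R.
Proof.
move=> d0 /andP[a0 an]; set k := minn a n./2.
have d0' : 0 < d%:R :> R by rewrite ltr0n.
have d1 : 1 <= d%:R :> R by rewrite ler1n.
have e0 : 0 < expR 1 :> R by exact: expR_gt0.
have k2 : (k.*2 <= n)%N.
  by rewrite -[leqRHS]odd_double_half; apply: leq_trans (leq_addl _ _);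
     rewrite leq_double geq_minr.
(* If [a > n / 2], then [k] is the floor of [n / 2], and rounding costs the [+ 1]. *)
have ak : (a <= k.*2.+1)%N.
  rewrite /k; case: (leqP a n./2) => _; first by rewrite -addnn -addnS leq_addr.
  apply: leq_trans an _; rewrite -[leqLHS]odd_double_half.
  by case: (odd n) => /=; rewrite ?add1n ?add0n.
apply: le_trans (_ : (4 * d%:R * expR 1) ^+ d * 2 ^+ k <= _); last first.
  by rewrite ler_pM2l ?exprn_gt0 ?mulr_gt0 // -natrX ler_nat bin_ge_expn2.
have kd : 0 <= k%:R / (2 * d%:R) :> R by rewrite divr_ge0 // mulr_ge0.
apply: le_trans (_ : (4 * d%:R * expR 1 * expR (k%:R / (2 * d%:R))) ^+ d <= _).
  apply: lerXn2r; rewrite ?nnegrE ?(ltW (stirling_gt0 _ _)) //.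
    by rewrite !mulr_ge0 ?expR_ge0.
  apply: le_trans (stirling_linear _ a0) _.
  rewrite [4 * _ * _]mulrC -mulrA ler_pM2l //.
  apply: le_trans (_ : 4 * d%:R * (1 + k%:R / (2 * d%:R)) <= _); last first.
    by apply: ler_wpM2l; [rewrite mulr_ge0 | exact: expR_ge1Dx].
  have -> : 4 * d%:R * (1 + k%:R / (2 * d%:R)) = 4 * d%:R + 2 * k%:R :> R.
    by field; rewrite gt_eqF.
  have : a%:R <= (2 * k + 1)%N%:R :> R by rewrite ler_nat mul2n addn1.
  by rewrite natrD natrM => ?; lra.
rewrite exprMn ler_pM2l ?exprn_gt0 ?mulr_gt0 // -expRM_natr.
have -> : k%:R / (2 * d%:R) * d%:R = 1 / 2 * k%:R :> R by field; rewrite gt_eqF.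
rewrite expRM_natr; apply: lerXn2r; rewrite ?nnegrE ?expR_ge0 //.
rewrite -[X in _ <= X](@lnK R) ?posrE // ler_expR.
exact: ln2_ge.
Qed.

End Binomials.

(** * Union bound over the placements of the classes *)

Section UnionBound.
Variables (R : realType) (h K d n : nat) (adj : rel 'I_h).
Variables (a : 'I_h -> nat -> nat) (e : 'I_h -> nat -> 'I_h -> nat -> nat).
Let V := ('I_h * 'I_K)%type.
Let au (u : V) := a u.1 u.2.
Let eu (u v : V) := e u.1 u.2 v.1 v.2.
Let G (u v : V) := decP (Gamma_adj d n adj u.1 u.2 v.1 v.2).
Let cost (u v : V) : R :=
  poisson_cost (eu u v)%:R ((au u)%:R * (au v)%:R / n%:R).

Hypothesis n0 : (0 < n)%N.
Hypothesis adj_sym : forall i j, adj i j = adj j i.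
Hypothesis adj_irr : forall i, ~~ adj i i.
Hypothesis adj_deg : forall i, #|[set j | adj i j]| = d.
Hypothesis cost_sym : forall u v, G u v -> cost u v = cost v u.
Hypothesis G_sym : forall u v, G u v = G v u.

Let placement (A : {ffun V -> {set 'I_n}}) :=
  [forall u, #|A u| == au u] &&
  [forall u, forall v, (u.1 == v.1) && (u != v) ==> [disjoint A u & A v]].

Let edge (q : 'I_h * 'I_h) := adj q.1 q.2 && (q.1 < q.2)%N.

Let good (A : {ffun V -> {set 'I_n}}) (q : 'I_h * 'I_h) : {set {perm 'I_n}} :=
  [set s : {perm 'I_n} | edge q ==> [forall k, forall l, G (q.1, k) (q.2, l) ==>
     (#|[set j in A (q.1, k) | s j \in A (q.2, l)]| == eu (q.1, k) (q.2, l))]].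

(** For a fixed placement, different edges of H constrain different coordinates of [f], so the lifts
    realising it lie in a product of sets. *)
Lemma card_found :
  (#|[set f : {ffun 'I_h * 'I_h -> {perm 'I_n}} | decP (found d adj f a e)]|
    <= \sum_(A | placement A) \prod_q #|good A q|)%N.
Proof.
apply: leq_trans (_ : (#|\bigcup_(A | placement A) [set f in family (good A)]| <= _)%N).
  apply/subset_leq_card/subsetP => f; rewrite inE => /decPP[A [hA [hd he]]].
  apply/bigcupP; exists [ffun u : V => A u.1 u.2].
    apply/andP; split; first by apply/forallP => u; rewrite ffunE hA.
    apply/forallP => -[i k]; apply/forallP => -[i' k']; apply/implyP => /= /andP[/eqP <-].
    rewrite !ffunE /= => kk; apply: hd => kE; case/eqP: kk.
    by congr (_, _); exact: val_inj.
  rewrite inE; apply/familyP => -[i i']; rewrite inE /=.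
  apply/implyP => /andP[/= aii ii]; apply/forallP => k; apply/forallP => l.
  apply/implyP => /decPP /= /he eE; rewrite /eu /= -eE; apply/eqP.
  rewrite -(card_imset (f := fun j => (j, f (i, i') j))) => [|j j' []//].
  apply: eq_card => -[j j']; rewrite !inE /= !ffunE /= /lift_adj aii ii /=.
  rewrite [(i' < i)%N]ltnNge (ltnW ii) /= orbF.
  apply/imsetP/andP => [[j0]|[/andP[hj hj'] /eqP E]].
    by rewrite inE => /andP[h1 h2] [-> ->]; rewrite ?ffunE /= in h1 h2 *; rewrite h1 h2 eqxx.
  by exists j; rewrite ?inE ?ffunE /= ?E ?hj.
elim/big_rec2: _ => [|A m X _ IH]; first by rewrite cards0.
apply: leq_trans (leq_card_setU _ _) _; apply: leq_add => //.
by rewrite cardsE card_family foldrE big_image.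
Qed.

(** Each edge of Gamma occurs once with increasing and once with decreasing fibre indices; swapping
    the pair matches the two halves. *)
Lemma sum_edges (F : V -> V -> R) : (forall u v, G u v -> F u v = F v u) ->
  2 * (\sum_(q | edge q) \sum_k \sum_(l | G (q.1, k) (q.2, l)) F (q.1, k) (q.2, l))
  = \sum_u \sum_(v | G u v) F u v.
Proof.
move=> Fsym.
pose f i j := \sum_k \sum_(l | G (i, k) (j, l)) F (i, k) (j, l).
have fsym i j : f i j = f j i.
  rewrite /f (exchange_big_dep predT) //=; apply: eq_bigr => l _.
  under eq_bigl => k do rewrite G_sym.
  by apply: eq_bigr => k; rewrite G_sym => /Fsym ->.
have f0 i j : ~~ adj i j -> f i j = 0.
  move=> ij; rewrite /f big1 // => k _; rewrite big1 // => l /decPP[/= aij _].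
  by rewrite aij in ij.
have -> : \sum_u \sum_(v | G u v) F u v = \sum_i \sum_j f i j.
  have -> : \sum_u \sum_(v | G u v) F u v =
      \sum_i \sum_k \sum_(v | G (i, k) v) F (i, k) v.
    by rewrite pair_bigA /=; apply: eq_bigr => -[].
  apply: eq_bigr => i _; rewrite exchange_big /=; apply: eq_bigr => k _.
  by rewrite pair_big_dep /=; apply: eq_big => [[]|[]].
rewrite pair_bigA [RHS](bigID edge) /= mulr2n mulrDl mul1r; congr (_ + _).
rewrite [RHS](bigID (fun q : 'I_h * 'I_h => adj q.1 q.2)) /= addrC.
rewrite [X in _ = X + _]big1 ?add0r; last first.
  by move=> q /andP[_]; exact: f0.
rewrite (reindex_inj (h := fun q : 'I_h * 'I_h => (q.2, q.1))) /=; last first.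
  by move=> [i j] [i' j'] [-> ->].
apply: eq_big => [[i j]|[i j] _] /=; last exact: fsym.
rewrite /edge /= adj_sym; case: (boolP (adj i j)) => //= aij.
  rewrite -leqNgt andbT ltn_neqAle andb_idl // => _.
  by apply: contraTneq aij => /val_inj ->.
Qed.

(** Each edge of H contributes a factor from [card_perm_classes], and the binomials count the
    placements. The [2^-1] undoes the double count of the edges of Gamma. *)
Lemma prob_found_le :
  #|[set f : {ffun 'I_h * 'I_h -> {perm 'I_n}} | decP (found d adj f a e)]|%:R
    / #|{ffun 'I_h * 'I_h -> {perm 'I_n}}|%:R
  <= \prod_u ('C(n, au u)%:R * stirling R (au u) ^+ d) *
     expR (- (2^-1 * \sum_u \sum_(v | G u v) cost u v)).
Proof.
have nf : 0 < n`!%:R :> R by rewrite ltr0n fact_gt0.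
rewrite ler_pdivrMr; last first.
  by rewrite ltr0n; apply/card_gt0P; exists [ffun=> 1%g].
have -> : #|{ffun 'I_h * 'I_h -> {perm 'I_n}}|%:R = \prod_(q : 'I_h * 'I_h) n`!%:R :> R.
  by rewrite card_ffun card_Sn natrX prodr_const.
set B := \prod_u stirling R (au u) ^+ d * expR (- (2^-1 * \sum_u \sum_(v | G u v) cost u v)).
have step A : placement A ->
    (\prod_q #|good A q|)%N%:R <= B * \prod_(q : 'I_h * 'I_h) n`!%:R :> R.
  move=> /andP[/forallP hA /forallP hd].
  rewrite natr_prod.
  apply: le_trans (_ : \prod_q (n`!%:R * (if edge q then
      \prod_(l < K) stirling R (au (q.2, l)) *
      expR (- \sum_k \sum_(l | G (q.1, k) (q.2, l)) cost (q.1, k) (q.2, l)) else 1)) <= _).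
    apply: ler_prod => q _; rewrite ler0n /=.
    case: ifPn => hq; last first.
      by rewrite mulr1 ler_nat -card_Sn max_card.
    have triv i (k k' : 'I_K) : k != k' -> [disjoint A (i, k) & A (i, k')].
      move=> kk; have /forallP /(_ (i, k')) /implyP := hd (i, k); apply.
      by rewrite eqxx /=; apply: contraNneq kk => -[->].
    have T0 : (0 < #|'I_n|)%N by rewrite card_ord.
    have := card_perm_classes R (fun k l => G (q.1, k) (q.2, l))
      (fun k l => eu (q.1, k) (q.2, l)) T0 (triv q.1) (triv q.2).
    rewrite card_ord.
    have -> : \prod_l stirling R #|A (q.2, l)| = \prod_l stirling R (au (q.2, l)).
      by apply: eq_bigr => l _; rewrite (eqP (hA _)).
    have -> : \sum_k \sum_(l | G (q.1, k) (q.2, l)) poisson_cost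
         (eu (q.1, k) (q.2, l))%:R (#|A (q.1, k)|%:R * #|A (q.2, l)|%:R / n%:R) =
       \sum_k \sum_(l | G (q.1, k) (q.2, l)) cost (q.1, k) (q.2, l) :> R.
      apply: eq_bigr => k _; apply: eq_bigr => l _.
      by rewrite (eqP (hA _)) (eqP (hA _)).
    rewrite mulrA; apply: le_trans.
    by rewrite ler_nat; apply/subset_leq_card/subsetP => s; rewrite !inE hq.
  rewrite big_split /= mulrC ler_pM2r; last by apply: prodr_gt0.
  rewrite -big_mkcond big_split /= -expR_sum.
  rewrite /B sumrN -(sum_edges cost_sym) mulrA mulVf ?pnatr_eq0 // mul1r.
  rewrite ler_pM2r ?expR_gt0 //.
  (* The Stirling factor of a class occurs once per adjacent fibre of smaller index, so at most [d]
     times; being at least [1], it may be raised to the power [d]. *)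
  have -> : \prod_(q | edge q) \prod_(l < K) stirling R (au (q.2, l)) =
     \prod_(u : V) \prod_(i | edge (i, u.1)) stirling R (au u).
    have -> : \prod_(u : V) \prod_(i | edge (i, u.1)) stirling R (au u) =
        \prod_j \prod_l \prod_(i | edge (i, j)) stirling R (au (j, l)).
      by rewrite pair_bigA /=; apply: eq_bigr => -[].
    have -> : \prod_(q | edge q) \prod_(l < K) stirling R (au (q.2, l)) =
       \prod_i \prod_(j | edge (i, j)) \prod_(l < K) stirling R (au (j, l)).
      by rewrite [RHS]pair_big_dep /=; apply: eq_big => [[]|[]].
    rewrite (exchange_big_dep predT) //=; apply: eq_bigr => j _.
    by rewrite exchange_big.
  apply: ler_prod => u _; apply/andP; split.
    by apply: prodr_ge0 => i _; rewrite ltW ?stirling_gt0.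
  rewrite prodr_const; apply: ler_weXn2l; first exact: stirling_ge1.
  rewrite -(adj_deg u.1); apply/subset_leq_card/subsetP => i.
  by rewrite !inE /edge /= adj_sym => /andP[].
apply: le_trans (_ : (\sum_(A | placement A) \prod_q #|good A q|)%N%:R <= _).
  by rewrite ler_nat; exact: card_found.
rewrite natr_sum; apply: le_trans (ler_sum _ step) _.
rewrite sumr_const -[X in X <= _]mulr_natl big_split /= -!mulrA.
apply: ler_wpM2r.
  rewrite !mulr_ge0 ?expR_ge0 //; apply: prodr_ge0 => u _ //.
  by rewrite exprn_ge0 // ltW ?stirling_gt0.
rewrite -natr_prod ler_nat.
have -> : (\prod_u 'C(n, au u) = #|family (fun u => [set B : {set 'I_n} | #|B| == au u])|)%N.
  rewrite card_family foldrE big_image /=; apply: eq_bigr => u _.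
  by rewrite -[in LHS](card_ord n) -card_draws.
apply/subset_leq_card/subsetP => A; rewrite inE => /andP[/forallP hA _].
by apply/familyP => u; rewrite inE hA.
Qed.

End UnionBound.

(** * The contribution of one class to the final bound *)

Section VertexBound.
Variable R : realType.

Lemma ln_prod (I : finType) (P : pred I) (F : I -> R) :
  (forall i, P i -> 0 < F i) -> ln (\prod_(i | P i) F i) = \sum_(i | P i) ln (F i).
Proof.
move=> F0; suff: 0 < \prod_(i | P i) F i /\
  ln (\prod_(i | P i) F i) = \sum_(i | P i) ln (F i) by case.
elim/big_rec2: _ => [|i y x Pi [x0 xE]]; first by rewrite ln1.
by rewrite mulr_gt0 ?F0 // lnM ?posrE ?F0 // xE.
Qed.

(** Since [ln N <= l] for the truncated binomial [N] and the entropy [l], comparing exponents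
    reduces to [3 / 20 * L - 1 >= L / 10], that is, [L >= 20]. *)
Lemma vertex_bound (L : R) d n a : 20 <= L -> (0 < d)%N -> (0 < a <= n)%N ->
  'C(n, a)%:R * stirling R a ^+ d *
    expR (- (3 / 20 * L * (a%:R * (1 + ln (n%:R / a%:R)))))
  <= (4 * d%:R * expR 1) ^+ d *
     (expR (d%:R / 4 * ln a%:R) *
      expR ((1 - L / 10) * ln 'C(n, minn a n./2)%:R)).
Proof.
move=> L20 d0 an; have /andP[a0 aln] := an.
set l := a%:R * _; set N := 'C(n, minn a n./2)%:R; set C1 := (4 * _ * _) ^+ d.
have N0 : 0 < N.
  rewrite ltr0n bin_gt0; apply: leq_trans (geq_minr _ _) _.
  by rewrite -[leqRHS]odd_double_half -addnn addnCA leq_addr.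
have lnN : ln N <= l.
  rewrite -[l]expRK ler_ln ?posrE ?expR_gt0 //.
  by apply: bin_le_entropy => //; exact: geq_minl.
have l0 : 0 <= l.
  rewrite mulr_ge0 // addr_ge0 // ln_ge0 // ler_pdivlMr ?ltr0n //.
  by rewrite mul1r ler_nat.
have C10 : 0 < C1 by rewrite exprn_gt0 // !mulr_gt0 ?expR_gt0 ?ltr0n.
have la : 0 <= ln (a%:R : R) by rewrite ln_ge0 // ler1n.
apply: le_trans (_ : expR l * (C1 * N) * expR (- (3 / 20 * L * l)) <= _).
  rewrite ler_pM2r ?expR_gt0 //; apply: ler_pM.
  - exact: ler0n.
  - by rewrite exprn_ge0 // ltW ?stirling_gt0.
  - exact: bin_le_entropy.
  - exact: stirling_exp_le_bin.
have -> : expR l * (C1 * N) * expR (- (3 / 20 * L * l)) =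
    C1 * expR (l + ln N + - (3 / 20 * L * l)).
  by rewrite !expRD lnK ?posrE //; ring.
rewrite -expRD ler_pM2l // ler_expR.
have : 0 <= d%:R / 4 * ln (a%:R : R) by rewrite mulr_ge0 // divr_ge0.
have : 0 <= (L - 20) * l by rewrite mulr_ge0 // subr_ge0.
have : 0 <= L * (l - ln N) by rewrite mulr_ge0 ?subr_ge0 //; lra.
lra.
Qed.

End VertexBound.

Lemma wscE n h k : wsc n h k = 2 ^+ k * (Num.sqrt (n * h)%N%:R)^-1 :> R.
Proof. by rewrite /wsc RdivE RsqrtE !INRE natrX. Qed.

(** * The potency as a sum over ordered pairs *)

Section Potency.
Variables (h d n K : nat) (adj : rel 'I_h).
Variables (a : 'I_h -> nat -> nat) (e : 'I_h -> nat -> 'I_h -> nat -> nat).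
Let V := ('I_h * 'I_K)%type.
Let G (u v : V) := decP (Gamma_adj d n adj u.1 u.2 v.1 v.2).
Let x (u v : V) : R := wsc n h u.2 * wsc n h v.2 *
  ((e u.1 u.2 v.1 v.2)%:R - (a u.1 u.2)%:R * (a v.1 v.2)%:R / n%:R).
Hypothesis adj_sym : forall i j, adj i j = adj j i.
Hypothesis adj_irr : forall i, ~~ adj i i.
Hypothesis e_sym : forall u v, G u v -> e u.1 u.2 v.1 v.2 = e v.1 v.2 u.1 u.2.
Hypothesis G_sym : forall u v, G u v = G v u.

Lemma potencyE : 2 * potency d n K adj a e = `|\sum_u \sum_(v | G u v) x u v|.
Proof.
have xsym u v : G u v -> x u v = x v u.
  by move=> guv; rewrite /x (e_sym guv); congr (_ * (_ - _ / _)); exact: mulrC.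
rewrite -(sum_edges adj_sym adj_irr G_sym xsym) normrM [`|2|]ger0_norm //.
congr (_ * _); rewrite /potency RabsE; congr `|_|.
rewrite (eq_bigl (fun q : 'I_h * 'I_h => predT q.1 && (adj q.1 q.2 && (q.1 < q.2)%N))) //.
rewrite -(pair_big_dep predT (fun i j : 'I_h => adj i j && (i < j)%N)
  (fun i j => \sum_k \sum_(l | G (i, k) (j, l)) x (i, k) (j, l))) /=.
apply: eq_bigr => i _.
rewrite [RHS]big_mkcondl [LHS]big_mkcond [RHS]big_mkcond /=; apply: eq_bigr => j _.
case: ifP => // ij.
case: ifPn => aij; last first.
  rewrite big1 // => k _; rewrite big1 // => l /decPP[aij' _].
  by rewrite aij' in aij.
apply: eq_bigr => k _; apply: eq_bigr => l _.
by rewrite /x /= !INRE RdivE.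
Qed.

End Potency.

Lemma IZR_nat k : IZR (Z.of_nat k) = k%:R :> R.
Proof. by rewrite -INR_IZR_INZ INRE. Qed.

(** * Applying selection and union bound to a pattern *)

Section Main.
Variables (h d : nat) (adj : rel 'I_h) (L : R) (n K : nat).
Variables (a : 'I_h -> nat -> nat) (e : 'I_h -> nat -> 'I_h -> nat -> nat).
Hypothesis d2 : (2 <= d)%N.
Hypothesis reg : d_regular d adj.
Hypothesis L20 : 20 <= L.
Hypothesis n0 : (0 < n)%N.
Hypothesis pat : is_pattern d n K adj a e.

Let V := ('I_h * 'I_K)%type.
Let c : R := (Num.sqrt (n * h)%N%:R)^-1.
Let sd : R := Num.sqrt d%:R.
Let w (u : V) : R := 2 ^+ u.2 * c.
Let G (u v : V) := decP (Gamma_adj d n adj u.1 u.2 v.1 v.2).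
Let au (u : V) : R := (a u.1 u.2)%:R.
Let eu (u v : V) : R := (e u.1 u.2 v.1 v.2)%:R.
Let C1 : R := (4 * d%:R * expR 1) ^+ d.

Let adj_irr i : ~~ adj i i. Proof. by case: reg. Qed.
Let adj_sym i j : adj i j = adj j i. Proof. by case: reg => _ []. Qed.
Let adj_deg i : #|[set j | adj i j]| = d. Proof. by case: reg => _ []. Qed.
Let d0 : (0 < d)%N. Proof. exact: leq_trans d2. Qed.

Let sd1 : 1 <= sd.
Proof. by rewrite -sqrtr1 ler_wsqrtr // ler1n. Qed.

Let sd2 : sd ^+ 2 = d%:R.
Proof. by rewrite sqr_sqrtr // ler0n. Qed.

Let c0 : 'I_h -> 0 < c.
Proof.
case=> i ih; rewrite invr_gt0 sqrtr_gt0 ltr0n muln_gt0 n0 /=.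
by case: (h) ih.
Qed.

Let GE u v : G u v = adj u.1 v.1 && (sd^-1 < w u / w v < sd).
Proof.
apply/decPP/idP => [[-> ]|/andP[aij /andP[h1 h2]]].
  rewrite !wscE RdivE RinvE RsqrtE INRE -/c -/sd -/(w u) -/(w v).
  by case=> /RltP -> /RltP ->.
split => //; rewrite !wscE RdivE RinvE RsqrtE INRE -/c -/sd -/(w u) -/(w v).
by split; apply/RltP.
Qed.

Let G_sym u v : G u v = G v u.
Proof.
have sd0 : 0 < sd := lt_le_trans ltr01 sd1.
have w0 u' : 0 < w u' by rewrite mulr_gt0 ?exprn_gt0 // (c0 u'.1).
have inv (z : R) : 0 < z -> (sd^-1 < z) = (z^-1 < sd).
  by move=> z0; rewrite -{1}(invrK z) ltf_pV2 ?posrE ?invr_gt0.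
rewrite !GE adj_sym (inv _ (divr_gt0 (w0 u) (w0 v))) (inv _ (divr_gt0 (w0 v) (w0 u))).
by rewrite (invf_div (w u)) (invf_div (w v)) [X in _ && X]andbC.
Qed.

Let e_pat u v : G u v -> e u.1 u.2 v.1 v.2 = e v.1 v.2 u.1 u.2 /\
  (e u.1 u.2 v.1 v.2 <= minn (a u.1 u.2) (a v.1 v.2))%N.
Proof. by case: pat => _ [_ [_ he]] /decPP; exact: he. Qed.

Let a_le_n (u : V) : (a u.1 u.2 <= n)%N.
Proof.
case: pat => /(_ u.1) hn _; apply: leq_trans hn.
by rewrite (bigD1 u.2) //= leq_addr.
Qed.

(** The scales in use lie within a factor [d < 2 ^ d] and are dyadic, so each fibre has at most [d]
    of them. This keeps the final constant free of [n] and of the pattern. *)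
Let card_active : (#|[set u : V | (0 < a u.1 u.2)%N]| <= h * d)%N.
Proof.
case: pat => _ [_ [[k0 hk] _]].
have range (u : V) : (0 < a u.1 u.2)%N -> (k0 <= u.2 < k0 + d)%N.
  move=> a0; have ne : a u.1 u.2 <> 0%N by move=> z; rewrite z in a0.
  have [/RleP h1 /RleP h2] := hk _ _ ne.
  have cp := c0 u.1.
  move: h1 h2; rewrite !wscE RmultE INRE mulrA !ler_pM2r //.
  rewrite -!natrX -natrM !ler_nat leq_exp2l // => -> h2 /=.
  rewrite ltnNge; apply/negP => hge.
  have := leq_trans (leq_pexp2l (isT : 0 < 2)%N hge) h2.
  rewrite expnD mulnC leq_pmul2r ?expn_gt0 //.
  by rewrite leqNgt ltn_expl.
have sub : [set u : V | (0 < a u.1 u.2)%N] \subset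
    setX [set: 'I_h] [set k : 'I_K | (k0 <= k < k0 + d)%N].
  by apply/subsetP => u; rewrite !inE => /range.
apply: leq_trans (subset_leq_card sub) _; rewrite cardsX cardsT card_ord leq_mul2l.
apply/orP; right; rewrite cardE -(size_map val) -[leqRHS](size_iota k0 d).
apply: uniq_leq_size; first by rewrite map_inj_uniq ?enum_uniq //; exact: val_inj.
by move=> k /mapP[k' + ->]; rewrite mem_enum inE mem_iota.
Qed.

Let weight : \sum_u w u ^+ 2 * au u <= 10.
Proof.
case: pat => _ [/RleP hw _]; move: hw.
have -> : IZR 10 = 10%:R by rewrite -(IZR_nat 10).
apply: le_trans; rewrite le_eqVlt; apply/orP; left; apply/eqP.
have -> : \sum_u w u ^+ 2 * au u = \sum_i \sum_k w (i, k) ^+ 2 * au (i, k).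
  by rewrite pair_bigA; apply: eq_bigr => -[].
apply: eq_bigr => i _; apply: eq_bigr => k _.
by rewrite RmultE RpowE wscE INRE.
Qed.

(** The selected set lives on scales in ['I_K]; scales from [K] on are left out of [S]. *)
Let restrict (S0 : {set V}) : 'I_h -> nat -> bool := fun i k =>
  if insub k is Some k' then (i, k') \in S0 else false.

Let restrictE S0 (u : V) : restrict S0 u.1 u.2 = (u \in S0).
Proof. by case: u => i k; rewrite /restrict /= valK. Qed.

Let sum_restrict (S0 : {set V}) (F F' : V -> V -> R) :
  (forall u v, F' u v = if (u \in S0) && (v \in S0) then F u v else 0) ->
  \sum_u \sum_(v | G u v) F' u v = \sum_(u in S0) \sum_(v in S0 | G u v) F u v.
Proof.
move=> FE; rewrite [RHS]big_mkcond; apply: eq_bigr => u _.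
case: ifP => uS; last by rewrite big1 // => v _; rewrite FE uS.
rewrite big_mkcond [RHS]big_mkcond; apply: eq_bigr => v _.
by rewrite FE uS /=; case: (G u v); case: (v \in S0).
Qed.

Lemma pattern_selection : exists S : 'I_h -> nat -> bool,
  potency d n K adj a e - 150 * L * sd
    <= potency d n K adj (sub_a S a) (sub_e S e) /\
  prob_found d n adj (sub_a S a) (sub_e S e) <= C1 ^+ (h * d) *
    (\prod_(i < h) \prod_(k < K | S i k && (0 < a i k)%N)
       expR (d%:R / 4 * ln (a i k)%:R)) *
    expR ((1 - L / 10) * ln (\prod_(i < h) \prod_(k < K | S i k && (0 < a i k)%N)
       'C(n, minn (a i k) n./2))%N%:R).
Proof.
have a_bnd u : au u = 0 \/ 0 < au u <= n%:R.
  rewrite /au ler_nat a_le_n ltr0n andbT.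
  by case: (a u.1 u.2) => [|k]; [left | right].
have e_sym u v : G u v -> eu u v = eu v u by rewrite /eu => /e_pat[->].
have e_bnd u v : G u v -> [/\ 0 <= eu u v, eu u v <= au u & eu u v <= au v].
  by move=> /e_pat[_]; rewrite leq_min => /andP[h1 h2]; rewrite /eu /au ler0n !ler_nat.
have nR : 0 < n%:R :> R by rewrite ltr0n.
have e_sym' u v : adj u.1 v.1 && (sd^-1 < w u / w v < sd) -> eu u v = eu v u.
  by rewrite -GE; exact: e_sym.
have e_bnd' u v : adj u.1 v.1 && (sd^-1 < w u / w v < sd) ->
    [/\ 0 <= eu u v, eu u v <= au u & eu u v <= au v].
  by rewrite -GE; exact: e_bnd.
have [S0 [hp hc]] := selection adj_sym adj_irr adj_deg c0 nR sd1 sd2 L20 a_bnd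
  weight e_sym' e_bnd'.
pose S := restrict S0; exists S.
pose x (u v : V) : R := w u * w v * (eu u v - au u * au v / n%:R).
pose cost (u v : V) : R := poisson_cost (eu u v) (au u * au v / n%:R).
have {}hp : `|\sum_u \sum_(v | G u v) x u v| - 2 * (150 * L * sd) <=
    `|\sum_(u in S0) \sum_(v in S0 | G u v) x u v|.
  apply: le_trans (le_trans hp _).
    rewrite le_eqVlt; apply/orP; left; apply/eqP; congr (`|_| - _).
    by apply: eq_bigr => u _; apply: eq_bigl => v; rewrite GE.
  rewrite le_eqVlt; apply/orP; left; apply/eqP; congr `|_|.
  by apply: eq_bigr => u _; apply: eq_bigl => v; rewrite GE.
have {}hc u : u \in S0 -> 3 / 10 * L * (au u * (1 + ln (n%:R / au u))) <=
    \sum_(v in S0 | G u v) cost u v.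
  move=> /hc /le_trans; apply; rewrite le_eqVlt; apply/orP; left; apply/eqP.
  by apply: eq_bigl => v; rewrite GE.
have aS (u : V) : (sub_a S a u.1 u.2)%:R = (if u \in S0 then au u else 0) :> R.
  by rewrite /sub_a /S restrictE; case: ifP.
have eS (u v : V) : (sub_e S e u.1 u.2 v.1 v.2)%:R =
    (if (u \in S0) && (v \in S0) then eu u v else 0) :> R.
  by rewrite /sub_e /S !restrictE; case: ifP.
have e_symS (u v : V) : G u v -> sub_e S e u.1 u.2 v.1 v.2 = sub_e S e v.1 v.2 u.1 u.2.
  by move=> /e_pat[eE _]; rewrite /sub_e andbC eE.
split.
  rewrite -(ler_pM2l (ltr0Sn R 1)) mulrBr.
  rewrite (potencyE _ adj_sym adj_irr (fun u v guv => proj1 (@e_pat u v guv)) G_sym).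
  rewrite (potencyE _ adj_sym adj_irr e_symS G_sym).
  apply: le_trans (le_trans hp _); rewrite le_eqVlt; apply/orP; left; apply/eqP.
    congr (`|_| - _); apply: eq_bigr => u _; apply: eq_bigr => v _.
    by rewrite !wscE.
  rewrite -(sum_restrict (F' := fun u v : V => wsc n h u.2 * wsc n h v.2 *
     ((sub_e S e u.1 u.2 v.1 v.2)%:R -
      (sub_a S a u.1 u.2)%:R * (sub_a S a v.1 v.2)%:R / n%:R))) // => u v.
  rewrite !wscE eS !aS /x /w -/c.
  by case: (u \in S0); case: (v \in S0); rewrite //= ?mul0r ?mulr0 ?mul0r subr0 mulr0.
pose costS (u v : V) : R := poisson_cost (sub_e S e u.1 u.2 v.1 v.2)%:R
  ((sub_a S a u.1 u.2)%:R * (sub_a S a v.1 v.2)%:R / n%:R).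
have cost_symS (u v : V) : G u v -> costS u v = costS v u.
  by move=> guv; rewrite /costS (e_symS _ _ guv) [_ * (sub_a _ _ v.1 _)%:R]mulrC.
rewrite /prob_found RdivE !INRE.
apply: le_trans (prob_found_le n0 adj_sym adj_irr adj_deg cost_symS G_sym) _.
have costE : \sum_u \sum_(v | G u v) costS u v =
    \sum_(u in S0) \sum_(v in S0 | G u v) cost u v.
  apply: sum_restrict => u v; rewrite /costS eS !aS.
  case: (u \in S0); case: (v \in S0) => //=;
    by rewrite /poisson_cost ?mul0r ?mulr0 ?mul0r subrr addr0.
rewrite -/(costS _ _) costE.
pose act (u : V) := (u \in S0) && (0 < a u.1 u.2)%N.
pose l (u : V) : R := au u * (1 + ln (n%:R / au u)).
(* [3 / 20] is half of the [3 / 10] guaranteed at each vertex, as every edge is shared by its two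
   ends. *)
have hl : \sum_(u | act u) 3 / 20 * L * l u <=
    2^-1 * \sum_(u in S0) \sum_(v in S0 | G u v) cost u v.
  rewrite mulr_sumr big_mkcond [X in _ <= X]big_mkcond; apply: ler_sum => u _.
  rewrite /act; case: (boolP (u \in S0)) => //= uS; have := hc u uS.
  case: posnP => a0; rewrite /l /au ?a0 ?mul0r ?mulr0; lra.
apply: le_trans (_ : \prod_(u | act u) ('C(n, a u.1 u.2)%:R * stirling R (a u.1 u.2) ^+ d)
   * expR (- \sum_(u | act u) 3 / 20 * L * l u) <= _).
  apply: ler_pM.
  - apply: prodr_ge0 => u _.
    by rewrite mulr_ge0 ?ler0n // exprn_ge0 // ltW ?stirling_gt0.
  - exact: expR_ge0.
  - rewrite le_eqVlt; apply/orP; left; apply/eqP; rewrite [RHS]big_mkcond.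
    apply: eq_bigr => u _; rewrite /sub_a /S restrictE /act.
    case: (u \in S0) => /=; last by rewrite bin0 stirling0 expr1n mulr1.
    by case: posnP => // ->; rewrite bin0 stirling0 expr1n mulr1.
  - by rewrite ler_expR lerN2.
rewrite -sumrN expR_sum -big_split /=.
apply: le_trans (_ : \prod_(u | act u) (C1 * (expR (d%:R / 4 * ln (au u)) *
   expR ((1 - L / 10) * ln 'C(n, minn (a u.1 u.2) n./2)%:R))) <= _).
  apply: ler_prod => u /andP[_ a0]; apply/andP; split.
    rewrite mulr_ge0 ?expR_ge0 // mulr_ge0 ?ler0n //.
    by rewrite exprn_ge0 // ltW ?stirling_gt0.
  by apply: vertex_bound; rewrite ?a0 ?a_le_n.
rewrite !big_split /= -[X in _ * (_ * X)]expR_sum -mulr_sumr -ln_prod; last first.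
  move=> u _; rewrite ltr0n bin_gt0; apply: leq_trans (geq_minr _ _) _.
  by rewrite -[leqRHS]odd_double_half -addnn addnCA leq_addr.
have pairE (S' : Type) (idx : S') (op : Monoid.com_law idx) (F : 'I_h -> nat -> S') :
  \big[op/idx]_(i < h) \big[op/idx]_(k < K | S i k && (0 < a i k)%N) F i k =
  \big[op/idx]_(u | act u) F u.1 u.2.
  by rewrite pair_big_dep /=; apply: eq_bigl => u; rewrite /act -restrictE.
rewrite (pairE _ _ _ (fun i k => expR (d%:R / 4 * ln (a i k)%:R))).
rewrite (pairE _ _ _ (fun i k => 'C(n, minn (a i k) n./2))).
rewrite natr_prod mulrA ler_pM2r ?expR_gt0 //.
apply: ler_wpM2r; first by apply: prodr_ge0 => u _; exact: expR_ge0.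
(* As [C1 >= 1], its exponent, the number of nonempty selected classes, may be raised to [h * d]. *)
rewrite prodr_const; apply: ler_weXn2l.
  rewrite -[1](expr1n _ d); apply: lerXn2r; rewrite ?nnegrE ?ler01 //.
    by rewrite !mulr_ge0 ?expR_ge0.
  have h1 : 1 <= expR 1 :> R by rewrite ltW // expR_gt1.
  have h2 : 1 <= d%:R :> R by rewrite ler1n.
  have h3 : 1 <= d%:R * expR 1 :> R by exact: mulr_ege1.
  by rewrite -mulrA; lra.
apply: leq_trans card_active; apply/subset_leq_card/subsetP => u.
by rewrite inE => /andP[].
Qed.

End Main.

(** * The theorem, by translation to the Stdlib reals *)

Unset Implicit Arguments.
Local Open Scope R_scope.

Theorem theorem6p2 (h d : nat) (adjH : rel 'I_h) :
  (2 <= d)%N -> d_regular d adjH ->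
  forall L : R, (20 <= L) ->
  exists C : R,
  forall (n K : nat) (a : 'I_h -> nat -> nat)
         (e : 'I_h -> nat -> 'I_h -> nat -> nat),
    (0 < n)%N -> supported_below K a -> is_pattern d n K adjH a e ->
    exists S : 'I_h -> nat -> bool,
      (potency d n K adjH (sub_a S a) (sub_e S e)
         >= potency d n K adjH a e - 150 * L * sqrt (INR d)) /\
      (prob_found d n adjH (sub_a S a) (sub_e S e)
         <= C
            * \big[Rmult/1]_(i < h) \big[Rmult/1]_(k < K | S i k && (0 < a i k)%N)
                 Rpower (INR (a i k)) (INR d / 4)
            * Rpower (INR ((\prod_(i < h) \prod_(k < K | S i k && (0 < a i k)%N)
                             'C(n, minn (a i k) n./2))%N))
                     (1 - L / 10)).
Proof.
move=> d2 reg L L20.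
have IZRE k : IZR (Z.of_nat k) = k%:R%R := IZR_nat k.
have L20' : (20%:R <= L)%R by apply/RleP; rewrite -IZRE.
(* One factor [(4 d e) ^ d] for each of the at most [h * d] nonempty classes. *)
exists (((4 * d%:R * expR 1) ^+ d) ^+ (h * d)%N)%R => n K a e n0 _ pat.
have [S [h1 h2]] := pattern_selection d2 reg L20' n0 pat; exists S; split.
  apply/Rle_ge/RleP; rewrite RminusE !RmultE RsqrtE INRE.
  by have -> : 150 = 150%:R%R by rewrite -(IZRE 150%N).
apply/RleP; apply: le_trans h2 _; rewrite le_eqVlt; apply/orP; left; apply/eqP.
have RpowerE (x : nat) y : Rpower (INR x) y = expR (y * ln x%:R)%R.
  by rewrite /Rpower RexpE RlnE INRE.
rewrite RpowerE; congr (_ * _ * expR ((1 - L / _) * _))%R; last first.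
  by rewrite -(IZRE 10%N).
apply: eq_bigr => i _; apply: eq_bigr => k _.
rewrite RpowerE RdivE INRE; congr (expR (_ / _ * _))%R.
by rewrite -(IZRE 4%N).
Qed.
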